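(* Let $K$ be a field of characteristic zero, let $W\subseteq V$ be $K$-vector spaces of dimensions $m$ and $m+n$, let $X=\mathrm{SL}(V)/P=\mathbb{G}(m,m+n)$, and let $v$ be the highest weight vector of the irreducible $\mathrm{SL}(V)$-module $\mathrm{H}^0(X,\mathcal{O}_X(d))^*$. Let $l\geq 1$ be an integer. Let $z_1,\dots,z_D$ be a basis for $\mathfrak{n}$, where $D=mn$. Then the set $$\Big\{z_1^{v_1}\cdots z_D^{v_D}(v):\ 0\leq\sum_i v_i\leq l\Big\}$$ (with $v_i\geq0$ integers) is a basis for $\mathrm{U}_l(\mathfrak{g})v$ as a $K$-vector space. Moreover $$\dim_K(\mathrm{U}_l(\mathfrak{g})v)=\binom{D+l}{D}.$$
   Context: $G=\mathrm{SL}(V)$, $P\subseteq G$ is the parabolic subgroup fixing (stabilizing) $W$; $e_1,\dots,e_{m+n}$ is a basis of $V$ with $e_1,\dots,e_m$ a basis of $W$. $X=G/P$ is the grassmannian of $m$-planes in $V$. $\mathcal{O}_X(d)=i^*\mathcal{O}(1)^{\otimes d}$ where $i:X\to\mathbb{P}(\wedge^mV^* )$ is the Plücker embedding. $\mathrm{H}^0(X,\mathcal{O}_X(d))^*$ is an irreducible $G$-module and $v$ is its highest weight vector (unique up to scalar) with respect to the upper triangular Borel subgroup. $\mathfrak{g}=\mathrm{Lie}(G)$ consists of traceless matrices of size $m+n$; $\mathfrak{n}\subseteq\mathfrak{g}$ is the sub Lie algebra of block matrices $\begin{pmatrix}0&0\\ Y&0\end{pmatrix}$, where the diagonal blocks have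 sizes $m\times m$ and $n\times n$ and $Y$ is an arbitrary $n\times m$ block. $\mathrm{U}(\mathfrak{g})$ is the universal enveloping algebra, $\mathrm{U}_l(\mathfrak{g})$ the $l$'th piece of its canonical filtration (span of products of at most $l$ elements of $\mathfrak{g}$), and $\mathrm{U}_l(\mathfrak{g})v=\{x(v):x\in\mathrm{U}_l(\mathfrak{g})\}$.
   Formalization: The hypothesis l ≤ d is added: without it the claim is false when D ≥ 1 (for m = n = d = 1 and l = 2 the module has dimension 2, not 3), since some root vector z in 𝔫 has z^{d+1}v = 0. *)

(* Defs.v *)
From HB Require Import structures.
From mathcomp Require Import all_boot all_order all_algebra.
From mathcomp Require Import boolp classical_sets functions.
From mathcomp Require Import perm mpoly ring.

Set Implicit Arguments.
Unset Strict Implicit.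
Unset Printing Implicit Defensive.

Import GRing.Theory.

Local Open Scope classical_set_scope.
Local Open Scope ring_scope.

Section LinearAlgebra.
Variables (K : fieldType) (M : lmodType K).

Definition lin_indep (I : finType) (b : I -> M) : Prop :=
  forall c : I -> K, \sum_i c i *: b i = 0 -> forall i, c i = 0.

Definition lin_span (I : finType) (b : I -> M) : set M :=
  [set w | exists c : I -> K, w = \sum_i c i *: b i].

(* S is meant to be a linear subspace, which [lin_span b = S] enforces. *)
Definition is_basis (S : set M) (I : finType) (b : I -> M) : Prop :=
  lin_indep b /\ lin_span b = S.

Definition has_dim (S : set M) (k : nat) : Prop :=
  exists b : 'I_k -> M, is_basis S b.

Definition linear_forms : {pred (M -> K^o)} := fun phi => `[< linear phi >].

Fact linear_forms_submod_closed : submod_closed linear_forms.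
Proof.
split=> [|c f g /asboolP hf /asboolP hg]; apply/asboolP=> a u w.
  by change (0 = a *: (0 : K^o) + 0); rewrite scaler0 addr0.
change (c *: f (a *: u + w) + g (a *: u + w) =
        a *: (c *: f u + g u) + (c *: f w + g w)).
by rewrite hf hg !scalerDr !scalerA [c * a]mulrC addrACA.
Qed.

HB.instance Definition _ := GRing.isSubmodClosed.Build K (M -> K^o)
  linear_forms linear_forms_submod_closed.

Record dual := MkDual { dual_val :> M -> K^o; _ : dual_val \in linear_forms }.
HB.instance Definition _ := [isSub for dual_val].
HB.instance Definition _ := [Choice of dual by <:].
HB.instance Definition _ := [SubChoice_isSubLmodule of dual by <:].

Lemma dualP (phi : dual) : linear (phi : M -> K^o).
Proof. by case: phi => phi hphi; apply/asboolP. Qed.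

(* The transpose of the linear operator T. *)
Definition transpose (T : {linear M -> M}) (phi : dual) : dual.
Proof.
exists (fun s => phi (T s)).
by apply/asboolP=> a u w; rewrite linearP dualP.
Defined.

End LinearAlgebra.

(* In what follows V = K^(m+n) is the space of column vectors, with standard
   basis e_1, ..., e_{m+n}, and W is the span of e_1, ..., e_m. *)

Section Grassmannian.
Variables (K : fieldType) (m n : nat).

(* A point of the grassmannian X is the column span of an m-frame, a matrix
   with m linearly independent columns a_1, ..., a_m; the frame moreover singles
   out a nonzero vector a_1 /\ ... /\ a_m on the line of \wedge^m V which is
   the image of that point under the Plücker embedding. *)
Definition frame := {A : 'M[K]_(m + n, m) | \rank A == m}.

(* The coordinates of a_1 /\ ... /\ a_m are indexed here by all the maps f from
   {1..m} to {1..m+n}, that is, \wedge^m V is seen inside the m-th tensor power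
   of V.  They alternate in f, so those with f increasing determine the other
   ones and the redundancy does not affect the polynomial functions. *)
Local Notation N := #|{: {ffun 'I_m -> 'I_(m + n)}}|.

Definition plucker (A : 'M[K]_(m + n, m)) (k : 'I_N) : K :=
  \det (rowsub (enum_val k) A).

(* The fibre of O_X(d) over a point of X consists of the degree d homogeneous
   functions on the corresponding line of \wedge^m V, so that a section of
   O_X(d) is a function of the frame.  Over the affine open subset where the
   linear form L does not vanish, the regular sections of O_X(d) are the
   restrictions to X of those of O(d), i.e. the fractions P / L^e with P a form
   of degree d + e. *)
Definition is_section (d : nat) (s : frame -> K^o) : Prop :=
  forall L : {mpoly K[N]}, L \is 1.-homog ->
    exists (e : nat) (P : {mpoly K[N]}),
      P \is (d + e)%N.-homog /\
      forall A : frame, L.@[plucker (val A)] != 0 ->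
        s A = P.@[plucker (val A)] / L.@[plucker (val A)] ^+ e.

Definition sections (d : nat) : {pred (frame -> K^o)} :=
  fun s => `[< is_section d s >].

Fact sections_submod_closed d : submod_closed (sections d).
Proof.
split=> [|c s1 s2 /asboolP h1 /asboolP h2]; apply/asboolP.
  move=> L hL; exists 0%N, 0; split; first exact: dhomog0.
  by move=> A _; rewrite meval0 mul0r.
move=> L hL; have [e1 [P1 [hP1 s1E]]] := h1 L hL.
have [e2 [P2 [hP2 s2E]]] := h2 L hL.
exists (e1 + e2)%N, (c *: (P1 * L ^+ e2) + P2 * L ^+ e1); split.
  have hX e : L ^+ e \is e.-homog by rewrite -[X in X.-homog]mul1n dhomogMn.
  rewrite rpredD ?rpredZ //.
    by rewrite addnA dhomogM.
  by rewrite [(e1 + e2)%N]addnC addnA dhomogM.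
move=> A LA0; rewrite !fctE /= s1E // s2E //.
rewrite mevalD mevalZ !mevalM !rmorphXn /= exprD invfM mulrDl /GRing.scale /=.
have u1 : L.@[plucker (val A)] ^+ e1 \is a GRing.unit by rewrite unitfE expf_neq0.
have u2 : L.@[plucker (val A)] ^+ e2 \is a GRing.unit by rewrite unitfE expf_neq0.
congr (_ + _).
  by rewrite -!mulrA; congr (_ * (_ * _)); rewrite mulrCA divrr // mulr1.
by rewrite -!mulrA; congr (_ * _); rewrite mulrA divrr // mul1r.
Qed.

HB.instance Definition _ d := GRing.isSubmodClosed.Build K (frame -> K^o)
  (sections d) (sections_submod_closed d).

(* H^0(X, O_X(d)) *)
Record H0 (d : nat) := MkH0 { H0_val :> frame -> K^o; _ : H0_val \in sections d }.
HB.instance Definition _ d := [isSub for @H0_val d].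
HB.instance Definition _ d := [Choice of H0 d by <:].
HB.instance Definition _ d := [SubChoice_isSubLmodule of H0 d by <:].

Lemma H0P d (s : H0 d) : is_section d s.
Proof. by case: s => s hs; apply/asboolP. Qed.

Definition SL := {g : 'M[K]_(m + n) | \det g == 1}.

Fact SL_unit (g : SL) : val g \in unitmx.
Proof. by rewrite unitmxE (eqP (valP g)) unitr1. Qed.

Fact SL_inv_subproof (g : SL) : \det (invmx (val g)) == 1.
Proof. by rewrite det_inv (eqP (valP g)) invr1. Qed.

Definition SL_inv (g : SL) : SL := Sub (invmx (val g)) (SL_inv_subproof g).

Fact SL_frame_subproof (g : SL) (A : frame) : \rank (val g *m val A) == m.
Proof. by rewrite (eqmxMfull _ _) ?row_full_unit ?SL_unit; case: A. Qed.

Definition SL_frame (g : SL) (A : frame) : frame :=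
  Sub (val g *m val A) (SL_frame_subproof g A).

(* [lin_subst g] is the tuple of linear forms expressing the Plücker coordinates
   of g A in terms of those of A. *)
Definition lin_subst (g : 'M[K]_(m + n)) : N.-tuple {mpoly K[N]} :=
  [tuple \sum_(k : 'I_N)
     (\prod_i g ((enum_val j : {ffun _}) i) ((enum_val k : {ffun _}) i)) *: 'X_k
  | j < N].

Lemma plucker_mulmx g A j :
  plucker (g *m A) j = (tnth (lin_subst g) j).@[plucker A].
Proof.
rewrite tnth_mktuple raddf_sum /=.
under eq_bigr do rewrite mevalZ mevalXU.
rewrite /plucker /determinant.
transitivity (\sum_(s : 'S_m) \sum_(h : {ffun 'I_m -> 'I_(m + n)})
    (-1) ^+ s * \prod_i (g ((enum_val j : {ffun _}) i) (h i) * A (h i) (s i))).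
  apply: eq_bigr => s _; rewrite -big_distrr /=; congr (_ * _).
  rewrite -(bigA_distr_bigA (fun i h => g ((enum_val j : {ffun _}) i) h * A h (s i))).
  by apply: eq_bigr => i _; rewrite !mxE.
rewrite exchange_big /=.
rewrite (reindex (enum_val : 'I_N -> {ffun 'I_m -> 'I_(m + n)})) /=; last first.
  by exists enum_rank => k _; rewrite ?enum_valK ?enum_rankK.
apply: eq_bigr => k _; rewrite big_distrr /=; apply: eq_bigr => s _.
rewrite big_split /= mulrCA; congr (_ * (_ * _)).
by apply: eq_bigr => i _; rewrite !mxE.
Qed.

Lemma lin_subst_homog g d P :
  P \is d.-homog -> P \mPo (lin_subst g) \is d.-homog.
Proof.
move/dhomogP=> hP; rewrite comp_mpolyEX big_seq rpred_sum // => mm /hP hm.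
rewrite rpredZ // comp_mpolyX -hm /= mdegE.
elim/big_rec2: _ => [|i a b _ hb]; first exact: dhomog1.
apply: dhomogM => //; rewrite -[X in X.-homog]mul1n; apply: dhomogMn.
rewrite tnth_mktuple rpred_sum // => k _; rewrite rpredZ //.
by rewrite dhomogX /= mdeg1.
Qed.

Fact SL_act_subproof d (g : SL) (s : H0 d) :
  (fun A => s (SL_frame (SL_inv g) A)) \in sections d.
Proof.
apply/asboolP=> L hL.
have [e [P [hP sE]]] := H0P s (lin_subst_homog (val g) hL).
exists e, (P \mPo lin_subst (val (SL_inv g))); split.
  exact: lin_subst_homog.
have mPoE (h : SL) Q (A : frame) : (Q \mPo lin_subst (val h)).@[plucker (val A)]
    = Q.@[plucker (val (SL_frame h A))].
  by rewrite comp_mpoly_meval; apply: meval_eq => j; rewrite -plucker_mulmx.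
have gK A : val (SL_frame g (SL_frame (SL_inv g) A)) = val A.
  by rewrite /= mulKVmx ?SL_unit.
by move=> A LA0; rewrite sE mPoE gK // mPoE.
Qed.

Definition SL_act_fun d (g : SL) (s : H0 d) : H0 d := MkH0 (SL_act_subproof g s).

Fact SL_act_linear d g : linear (@SL_act_fun d g).
Proof. by move=> c s t; apply/val_inj. Qed.

HB.instance Definition _ d g :=
  GRing.isLinear.Build K (H0 d) (H0 d) _ (@SL_act_fun d g) (@SL_act_linear d g).

Definition SL_act d (g : SL) : {linear H0 d -> H0 d} := @SL_act_fun d g.

(* The contragredient action on H^0(X, O_X(d))^*. *)
Definition SL_dual d (g : SL) (phi : dual (H0 d)) : dual (H0 d) :=
  transpose (SL_act d (SL_inv g)) phi.

Definition upper_triangular (b : 'M[K]_(m + n)) : Prop :=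
  forall i j : 'I_(m + n), (j < i)%N -> b i j = 0.

Definition highest_weight_vector d (v : dual (H0 d)) : Prop :=
  v != 0 /\
  forall b : SL, upper_triangular (val b) -> exists c : K, SL_dual b v = c *: v.

(* c is the derivative at t = 0 of t |-> s ((1 - t x) A), computed by means of
   an expression p / q of this function as a rational function of t. *)
Definition is_derivative (x : 'M[K]_(m + n)) (s : frame -> K) (A : frame)
    (c : K) : Prop :=
  exists p q : {poly K},
    [/\ q.[0] != 0,
        forall (t : K) (B : frame), val B = (1%:M - t *: x) *m val A ->
          q.[t] != 0 -> s B = p.[t] / q.[t]
      & c = (p^`().[0] * q.[0] - p.[0] * q^`().[0]) / q.[0] ^+ 2].

(* T is the differential at x of the action (g s) A = s (g^-1 A). *)
Definition is_differential d (x : 'M[K]_(m + n)) (T : {linear H0 d -> H0 d}) :=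
  forall (s : H0 d) (A : frame), is_derivative x s A (T s A).

(* The default value \0 is never reached in characteristic zero: see [Lie_actP]
   below. *)
Definition Lie_act d (x : 'M[K]_(m + n)) : {linear H0 d -> H0 d} :=
  if pselect (exists T, @is_differential d x T) is left h then projT1 (cid h)
  else \0.

(* The contragredient action on H^0(X, O_X(d))^*. *)
Definition Lie_dual d (x : 'M[K]_(m + n)) (phi : dual (H0 d)) : dual (H0 d) :=
  - transpose (Lie_act d x) phi.

Definition sl : set 'M[K]_(m + n) := [set x | \tr x = 0].

Definition lie_n : set 'M[K]_(m + n) :=
  [set x | exists Y : 'M[K]_(n, m), x = block_mx 0 0 Y 0].

(* The image of U_l(sl) in the K-linear endomorphisms of H^0(X, O_X(d))^*: the
   linear combinations of products x_1 ... x_k of k <= l elements of sl. *)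
Definition U_act d (l : nat) : set (dual (H0 d) -> dual (H0 d)) :=
  [set u | exists r : seq (K * seq 'M[K]_(m + n)),
     (forall cx, cx \in r ->
        (size cx.2 <= l)%N /\ forall x, x \in cx.2 -> sl x) /\
     u = fun phi => \sum_(cx <- r) cx.1 *: foldr (@Lie_dual d) phi cx.2].

Definition U_orbit d (l : nat) (v : dual (H0 d)) : set (dual (H0 d)) :=
  [set u v | u in @U_act d l].

(* z_1^{a_1} ... z_D^{a_D} (phi) *)
Definition monomial_act d D (z : 'I_D -> 'M[K]_(m + n)) (a : 'X_{1..D})
    (phi : dual (H0 d)) : dual (H0 d) :=
  foldr (fun i => iter (a i) (Lie_dual (z i))) phi (enum 'I_D).

End Grassmannian.

(* [Lie_act] is well defined: the derivative along x of a section is again a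
   section, and it is unique as K is infinite. *)
Section Differential.
Variables (K : fieldType) (m n : nat).
Local Notation N := #|{: {ffun 'I_m -> 'I_(m + n)}}|.
Local Notation along u := (mmap (@polyC K) u).

Lemma horner_along (u : 'I_N -> {poly K}) P t :
  (along u P).[t] = P.@[fun k => (u k).[t]].
Proof.
rewrite mevalE /mmap horner_sum; apply: eq_bigr => a _.
rewrite hornerM hornerC horner_prod; congr (_ * _).
by apply: eq_bigr => i _; rewrite horner_exp.
Qed.

Lemma deriv_along (u : 'I_N -> {poly K}) P :
  (along u P)^`() = \sum_k along u P^`M(k) * (u k)^`().
Proof.
have hM P1 P2 : (along u P1)^`() = \sum_k along u P1^`M(k) * (u k)^`() ->
   (along u P2)^`() = \sum_k along u P2^`M(k) * (u k)^`() ->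
   (along u (P1 * P2))^`() = \sum_k along u (P1 * P2)^`M(k) * (u k)^`().
  move=> h1 h2; rewrite rmorphM derivM h1 h2 big_distrl big_distrr /= -big_split /=.
  apply: eq_bigr => k _; rewrite mderivM rmorphD !rmorphM /=; ring.
have hC c : (along u c%:MP)^`() = \sum_k along u c%:MP^`M(k) * (u k)^`().
  rewrite mmapC derivC big1 // => k _.
  by rewrite mderivC mmap0 mul0r.
elim/mpolyind: P => [|c a P _ _ IH].
  by rewrite -mpolyC0.
rewrite mmapD derivD IH.
under [RHS]eq_bigr do rewrite mderivD mmapD mulrDl.
rewrite big_split /=; congr (_ + _).
rewrite -mul_mpolyC; apply: (hM) => //.
rewrite mpolyXE_id.
apply: (big_ind (fun P => (along u P)^`() = \sum_k along u P^`M(k) * (u k)^`())).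
- exact: (hC 1).
- exact: (hM).
move=> i _.
elim: (a i) => [|e IHe]; first exact: (hC 1).
rewrite exprS; apply: (hM) => //.
rewrite mmapX mmap1U (bigD1 i) //= big1 ?addr0 => [|k ki].
  by rewrite mderivX mnmE eqxx scale1r (_ : (U_(i) - U_(i) = 0)%MM) ?mpolyX0 ?mmapC ?mul1r //; last by apply/mnmP=> j; rewrite mnmBE subnn mnm0E.
by rewrite mderivX mnmE eq_sym (negbTE ki) scale0r mmap0 mul0r.
Qed.

Variables (x : 'M[K]_(m + n)).

Definition lcoef (j k : 'I_N) : {poly K} :=
  \prod_i (((1%:M : 'M[K]_(m + n))
              ((enum_val j : {ffun _}) i) ((enum_val k : {ffun _}) i))%:P
           - x ((enum_val j : {ffun _}) i) ((enum_val k : {ffun _}) i) *: 'X).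

Definition curve (A : 'M[K]_(m + n, m)) (j : 'I_N) : {poly K} :=
  \sum_k lcoef j k * (plucker A k)%:P.

Definition dform (j : 'I_N) : {mpoly K[N]} :=
  \sum_k (lcoef j k)^`().[0] *: 'X_k.

Definition dmp (P : {mpoly K[N]}) : {mpoly K[N]} :=
  \sum_j P^`M(j) * dform j.

Lemma horner_curve A j t :
  (curve A j).[t] = plucker ((1%:M - t *: x) *m A) j.
Proof.
rewrite plucker_mulmx tnth_mktuple raddf_sum /= horner_sum.
apply: eq_bigr => k _; rewrite hornerM hornerC mevalZ mevalXU; congr (_ * _).
rewrite /lcoef horner_prod; apply: eq_bigr => i _.
by rewrite hornerD hornerN hornerC hornerZ hornerX !mxE [t * _]mulrC.
Qed.

Lemma horner_curve0 A j : (curve A j).[0] = plucker A j.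
Proof. by rewrite horner_curve scale0r subr0 mul1mx. Qed.

Lemma deriv_curve0 A j : (curve A j)^`().[0] = (dform j).@[plucker A].
Proof.
rewrite /curve raddf_sum /= horner_sum /dform raddf_sum /=.
apply: eq_bigr => k _.
by rewrite mevalZ mevalXU derivM derivC mulr0 addr0 hornerM hornerC.
Qed.

Lemma deriv_along_curve A P :
  (along (curve A) P)^`().[0] = (dmp P).@[plucker A].
Proof.
rewrite deriv_along horner_sum /dmp raddf_sum /=; apply: eq_bigr => k _.
rewrite hornerM horner_along deriv_curve0 mevalM; congr (_ * _).
by apply: meval_eq => j; rewrite horner_curve0.
Qed.

Lemma dmp_homog d P : P \is d.-homog -> dmp P \is d.-homog.
Proof.
move=> /dhomogP hP; rewrite rpred_sum // => j _.
rewrite /mderiv big_distrl /= big_seq rpred_sum // => a /hP /= ha.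
have [->|aj0] := eqVneq (a j) 0%N; first by rewrite mul0r scale0r mul0r dhomog0.
rewrite -scalerAl rpredZ // (_ : d = (mdeg (a - U_(j)) + 1)%N); last first.
  by rewrite -ha -(mdeg1 j) -mdegD submK // lep1mP.
apply: dhomogM; first by rewrite dhomogX.
by rewrite rpred_sum // => k _; rewrite rpredZ // dhomogX /= mdeg1.
Qed.

Lemma frame_plucker (A : frame K m n) : exists k, plucker (val A) k != 0.
Proof.
have fA : row_full (val A) by case: A.
pose f : {ffun 'I_m -> 'I_(m + n)} := [ffun i => fullrankfun fA i].
exists (enum_rank f); rewrite /plucker enum_rankK -unitfE -unitmxE -row_full_unit.
rewrite (_ : rowsub _ _ = rowsub (fullrankfun fA) (val A)).
  exact: fullrowsub_full.
by apply/matrixP=> i j; rewrite !mxE ffunE.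
Qed.

Hypothesis charK : [pchar K] =i pred0.

Lemma poly0_char0 (p : {poly K}) : (forall t, p.[t] = 0) -> p = 0.
Proof.
move=> h; apply/eqP/negPn/negP=> p0.
have := @max_poly_roots _ p [seq (i%:R : K) | i <- iota 0 (size p)] p0.
rewrite size_map size_iota ltnn => /(_ _ _)/negP []//.
  by apply/allP=> t _; rewrite rootE h.
rewrite map_inj_uniq ?iota_uniq // => i j.
wlog ij : i j / (i <= j)%N => [hw|].
  by case/orP: (leq_total i j) => ij; [exact: hw | move=> /esym/hw ->].
move=> /esym/eqP; rewrite -subr_eq0 -natrB // ((pcharf0P K).1 charK) subn_eq0 => ji.
by apply/eqP; rewrite eqn_leq ij.
Qed.

Lemma is_derivative_uniq (s : frame K m n -> K) A c1 c2 :
  is_derivative x s A c1 -> is_derivative x s A c2 -> c1 = c2.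
Proof.
move=> [p1 [q1 [q10 h1 ->]]] [p2 [q2 [q20 h2 ->]]].
have [k kA] := frame_plucker A.
have E : p1 * q2 = p2 * q1.
  apply/eqP; rewrite -subr_eq0; apply/eqP.
  have : (p1 * q2 - p2 * q1) * (curve (val A) k * q1 * q2) = 0.
    apply: poly0_char0 => t; rewrite !(hornerM, hornerD, hornerN).
    have [->|q1t] := eqVneq q1.[t] 0; first by ring.
    have [->|q2t] := eqVneq q2.[t] 0; first by ring.
    rewrite horner_curve.
    have [->|ut] := eqVneq (plucker ((1%:M - t *: x) *m val A) k) 0; first by ring.
    have rB : \rank ((1%:M - t *: x) *m val A) == m.
      rewrite eqn_leq rank_leq_col /=.
      move: ut; rewrite /plucker -unitfE -unitmxE -row_full_unit => /eqP {1}<-.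
      by rewrite rowsubE mxrankM_maxr.
    pose B : frame K m n := exist (fun M => \rank M == m) _ rB.
    have e1 := h1 t B erefl q1t; have e2 := h2 t B erefl q2t.
    have -> : p1.[t] = s B * q1.[t] by rewrite e1 divfK.
    have -> : p2.[t] = s B * q2.[t] by rewrite e2 divfK.
    by ring.
  move/eqP; rewrite mulf_eq0 => /orP[/eqP //|]; rewrite !mulf_eq0 -orbA.
  case/or3P => /eqP z; first by move: kA; rewrite -horner_curve0 z horner0 eqxx.
    by move: q10; rewrite z horner0 eqxx.
  by move: q20; rewrite z horner0 eqxx.
have E0 := congr1 (fun p : {poly K} => p.[0]) E.
have E1 := congr1 (fun p : {poly K} => p^`().[0]) E.
move: E0 E1; rewrite /= !derivM !(hornerM, hornerD) => E0 E1.
apply/eqP; rewrite eqr_div ?expf_neq0 //; apply/eqP.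
move: (p1^`().[0]) (p2^`().[0]) (q1^`().[0]) (q2^`().[0]) p1.[0] p2.[0] E0 E1 q10 q20.
move: q1.[0] q2.[0] => q1' q2' dp1 dp2 dq1 dq2 a1 a2 E0 E1 q10 q20.
have -> : a1 = a2 * q1' / q2' by rewrite -E0 mulfK.
have -> : dp1 = (dp2 * q1' + a2 * dq1 - a2 * q1' / q2' * dq2) / q2'.
  rewrite -E1 -E0 mulfK //.
  have -> : dp1 * q2' + a1 * dq2 - a1 * dq2 = dp1 * q2' by ring.
  by rewrite mulfK.
by field.
Qed.

Variable d : nat.

Lemma derivative_chart (s : H0 K m n d) L e P (A : frame K m n) :
  (forall A : frame K m n, L.@[plucker (val A)] != 0 ->
     s A = P.@[plucker (val A)] / L.@[plucker (val A)] ^+ e) ->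
  L.@[plucker (val A)] != 0 ->
  is_derivative x s A
    ((dmp (P * L) * L ^+ e.+1 - P * L * dmp (L ^+ e.+1)).@[plucker (val A)]
      / L.@[plucker (val A)] ^+ (e.+1 + e.+1)).
Proof.
move=> sE LA.
exists (along (curve (val A)) (P * L)), (along (curve (val A)) (L ^+ e.+1)).
have E0 Q : (along (curve (val A)) Q).[0] = Q.@[plucker (val A)].
  by rewrite horner_along; apply: meval_eq => j; rewrite horner_curve0.
split.
- by rewrite E0 rmorphXn expf_neq0.
- move=> t B hB; rewrite !horner_along.
  have EB Q : Q.@[fun k => (curve (val A) k).[t]] = Q.@[plucker (val B)].
    by apply: meval_eq => j; rewrite horner_curve hB.
  rewrite !EB rmorphXn /= expf_eq0 /= => LB; rewrite sE // mevalM exprS.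
  by rewrite invfM mulrA mulfK // mulrC.
- by rewrite !deriv_along_curve !E0 mevalB !mevalM !rmorphXn /= -exprM mulnC mul2n -addnn.
Qed.

Lemma ex_derivative (s : H0 K m n d) : exists s' : H0 K m n d,
  forall A, is_derivative x s A (s' A).
Proof.
have ex A : exists c : K^o, is_derivative x s A c.
  have [k kA] := frame_plucker A.
  have hX : ('X_k : {mpoly K[N]}) \is 1.-homog by rewrite dhomogX /= mdeg1.
  have [e [P [_ sE]]] := H0P s hX.
  by eexists; apply: (derivative_chart sE); rewrite mevalXU.
have [s' s'E] := choice ex.
suff hs' : s' \in @sections K m n d by exists (MkH0 hs').
apply/asboolP=> L hL; have [e [P [hP sE]]] := H0P s hL.
exists (e.+1 + e.+1)%N, (dmp (P * L) * L ^+ e.+1 - P * L * dmp (L ^+ e.+1)).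
split.
  have hLe : L ^+ e.+1 \is e.+1.-homog by rewrite -[X in X.-homog]mul1n dhomogMn.
  have hPL : P * L \is (d + e.+1)%N.-homog.
    by rewrite addnS -addn1; apply: dhomogM.
  rewrite addnA rpredB //.
    by apply: dhomogM => //; exact: dmp_homog.
  by apply: dhomogM => //; exact: dmp_homog.
by move=> A LA; apply: (is_derivative_uniq (s'E A)); exact: derivative_chart.
Qed.

Lemma is_derivative_linear a (s1 s2 : frame K m n -> K) A c1 c2 :
  is_derivative x s1 A c1 -> is_derivative x s2 A c2 ->
  is_derivative x (fun B => a * s1 B + s2 B) A (a * c1 + c2).
Proof.
move=> [p1 [q1 [q10 h1 ->]]] [p2 [q2 [q20 h2 ->]]].
exists (a *: (p1 * q2) + p2 * q1), (q1 * q2); split.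
- by rewrite hornerM mulf_neq0.
- move=> t B hB; rewrite hornerM mulf_eq0 negb_or => /andP[q1t q2t].
  rewrite (h1 t) // (h2 t) // !(hornerD, hornerZ, hornerM).
  by field; rewrite ?q1t ?q2t.
- rewrite !(derivD, derivZ, derivM, hornerD, hornerZ, hornerM).
  by field; rewrite ?q10 ?q20.
Qed.

Lemma Lie_actP : is_differential x (@Lie_act K m n d x).
Proof.
rewrite /Lie_act; case: pselect => [h|[]]; first exact: (projT2 (cid h)).
have [f fE] := choice ex_derivative.
have f_lin : linear f.
  move=> a s t; apply/val_inj/funext => A /=.
  have := is_derivative_linear a (fE s A) (fE t A).
  exact: (is_derivative_uniq (fE (a *: s + t) A)).
pose fL := GRing.isLinear.Build K (H0 K m n d) (H0 K m n d) _ f f_lin.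
pose T : {linear H0 K m n d -> H0 K m n d} := HB.pack f fL.
by exists T.
Qed.

End Differential.

(* Main.v *)
(* On the big cell {[1; Y]} of the grassmannian a section is a polynomial in the
   entries of Y.  The abelian algebra n acts there by minus the partial
   derivatives, and all the monomials of degree at most d are sections of O(d).
   So if v is a multiple of the evaluation at Y = 0, then z^a v is a nonzero
   multiple of the a-th Taylor coefficient at 0; these coefficients are linearly
   independent for |a| <= d.  Every element of gl acts by a differential operator
   of order 1, hence U_l v only involves the Taylor coefficients of order <= l.

   That v is a multiple of the evaluation at 0 is shown by a Casimir argument.  The
   restriction of a section to a line A + t c r is a polynomial in t of degree at
   most d, so the Lie algebra operators are, by interpolation, averages of
   translations by elements of the group.  Hence the positive root vectors act on
   v by nilpotent scalars, that is, by 0, and the Euler operator H_j of the j-th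
   column of Y acts by some mu_j in {0, ..., d}.  A quadratic relation between
   H_j and root vectors gives mu_j = 0 by induction on j, so that v
   only depends on the component of degree 0 in each column. *)

Require Import Defs.
From HB Require Import structures.
From mathcomp Require Import all_boot all_order all_algebra.
From mathcomp Require Import boolp classical_sets functions.
From mathcomp Require Import fingroup perm qpoly mpoly ring.

Set Implicit Arguments.
Unset Strict Implicit.
Unset Printing Implicit Defensive.

Import GRing.Theory.

Local Open Scope classical_set_scope.
Local Open Scope ring_scope.

(** * Chain rule and identity principle for polynomials in characteristic zero *)

Section Polynomials.
Variable K : fieldType.

Lemma horner_mmap k (u : 'I_k -> {poly K}) P t :
  (mmap (@polyC K) u P).[t] = P.@[fun i => (u i).[t]].
Proof.
rewrite mevalE /mmap horner_sum; apply: eq_bigr => a _.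
rewrite hornerM hornerC horner_prod; congr (_ * _).
by apply: eq_bigr => i _; rewrite horner_exp.
Qed.

(** Chain rule: the identity is stable under sums and products, so constants and variables
    suffice. *)
Lemma deriv_mmap k (u : 'I_k -> {poly K}) P :
  (mmap (@polyC K) u P)^`() = \sum_i mmap (@polyC K) u P^`M(i) * (u i)^`().
Proof.
pose good P := (mmap (@polyC K) u P)^`() =
  \sum_i mmap (@polyC K) u P^`M(i) * (u i)^`().
have goodM P1 P2 : good P1 -> good P2 -> good (P1 * P2).
  rewrite /good => h1 h2; rewrite rmorphM derivM h1 h2 mulr_suml mulr_sumr -big_split /=.
  by apply: eq_bigr => i _; rewrite mderivM rmorphD !rmorphM /=; ring.
have goodC c : good c%:MP.
  rewrite /good mmapC derivC big1 // => i _.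
  by rewrite mderivC mmap0 mul0r.
have goodX i : good 'X_i.
  rewrite /good mmapX mmap1U (bigD1 i) //= big1 ?addr0 => [|j ji].
    rewrite mderivX mnmE eqxx scale1r (_ : (U_(i) - U_(i) = 0)%MM).
      by rewrite mpolyX0 rmorph1 mul1r.
    by apply/mnmP=> j; rewrite mnmBE subnn mnm0E.
  by rewrite mderivX mnmE eq_sym (negbTE ji) scale0r mmap0 mul0r.
have goodZX c a : good (c *: 'X_[a]).
  rewrite -mul_mpolyC; apply: (goodM) => //; rewrite mpolyXE_id.
  apply: (big_ind good); [exact: (goodC 1) | exact: goodM |] => i _.
  by elim: (a i) => [|e IHe]; [exact: (goodC 1) | rewrite exprS; exact: goodM].
elim/mpolyind: P => [|c a P _ _ IH]; first exact: (goodC 0).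
rewrite !mmapD !derivD goodZX IH -big_split /=.
by apply: eq_bigr => i _; rewrite mderivD mmapD mulrDl.
Qed.

Lemma meval_homogZ k e (P : {mpoly K[k]}) (c : K) (x : 'I_k -> K) :
  P \is e.-homog -> P.@[fun i => c * x i] = c ^+ e * P.@[x].
Proof.
move=> /dhomogP hP; rewrite !mevalE big_distrr /= !big_seq.
apply: eq_bigr => a /hP <-; rewrite mulrCA /=; congr (_ * _).
under eq_bigr do rewrite exprMn.
by rewrite big_split /= mdegE prodrXr.
Qed.

Lemma mnm_neq0 k (a : 'X_{1..k}) : a != 0%MM -> exists i, a i != 0%N.
Proof.
move=> a0; apply/existsP; apply: contraR a0; rewrite negb_exists => /forallP h.
by apply/eqP/mnmP=> i; rewrite mnm0E; apply/eqP; rewrite -[_ == _]negbK.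
Qed.

Lemma meval_origin k (P : {mpoly K[k]}) : P.@[fun=> 0] = P@_0.
Proof.
elim/mpolyind: P => [|c a P _ _ IH]; first by rewrite meval0 mcoeff0.
rewrite mevalD mevalZ IH mcoeffD mcoeffZ mcoeffX mevalX; congr (_ * _ + _).
have [->|/mnm_neq0 [i ai]] := eqVneq a 0%MM; first by rewrite big1 // => i _; rewrite mnm0E.
by rewrite (bigD1 i) //= expr0n (negbTE ai) mul0r.
Qed.

Hypothesis charK : [pchar K] =i pred0.

Lemma natr_inj_char0 : injective (fun i : nat => i%:R : K).
Proof.
move=> i j /=; wlog ij : i j / (i <= j)%N => [hw|].
  by case/orP: (leq_total i j) => ij; [exact: hw | move=> /esym/hw ->].
move=> /esym/eqP; rewrite -subr_eq0 -natrB // ((pcharf0P K).1 charK) subn_eq0 => ji.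
by apply/eqP; rewrite eqn_leq ij.
Qed.

Lemma natr_neq0_char0 i : (i != 0)%N -> i%:R != 0 :> K.
Proof. by rewrite ((pcharf0P K).1 charK). Qed.

(** Along a line parallel to an axis [P] restricts to the zero polynomial in one variable, so its
    partial derivatives vanish everywhere; by induction on the size they are 0, and [P] is
    constant. *)
Lemma meval_eq0_char0 k (P : {mpoly K[k]}) : (forall y, P.@[y] = 0) -> P = 0.
Proof.
have [e] := ubnP (msize P); elim: e P => // e IH P; rewrite ltnS => sP P0.
have dP i : P^`M(i) = 0.
  have [/msize1_polyC ->|s2] := leqP (msize P) 1; first by rewrite mderivC.
  apply: IH => [|y].
    apply: leq_trans sP.
    have [->|nz] := eqVneq P^`M(i) 0; first by rewrite msize0 (leq_trans _ s2).
    rewrite msizeE big_seq; elim/big_ind: _ => [|p q hp hq|a].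
    - by rewrite (leq_trans _ s2).
    - by rewrite gtn_max hp.
    rewrite mcoeff_msupp mcoeff_deriv => /eqP ca.
    have /msize_mdeg_lt : (a + U_(i))%MM \in msupp P.
      by rewrite mcoeff_msupp; apply/eqP=> z; apply: ca; rewrite z mul0rn.
    by rewrite mdegD mdeg1 addn1.
  pose u j : {poly K} := (y j)%:P + (j == i)%:R *: 'X.
  have z : mmap (@polyC K) u P = 0.
    by apply: (poly0_char0 charK) => t; rewrite horner_mmap P0.
  have /(congr1 (fun p : {poly K} => p.[0])) := deriv_mmap u P.
  rewrite z linear0 horner0 horner_sum (bigD1 i) //= big1 ?addr0 => [|j /negbTE ji].
    rewrite /u derivD derivC derivZ derivX eqxx scale1r add0r mulr1 horner_mmap => ->.
    by apply: meval_eq => j; rewrite hornerD hornerC hornerZ hornerX mulr0 addr0.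
  by rewrite /u derivD derivC derivZ derivX ji scale0r addr0 mulr0 horner0.
have PC : P = (P@_0)%:MP.
  apply/mpolyP=> a; rewrite mcoeffC; have [<-|] := eqVneq 0%MM a; rewrite ?mulr1 ?mulr0 //.
  (* The coefficient at [a - U_(i)] of the [i]-th derivative is [a i] times the coefficient of [P]
     at [a]. *)
  rewrite eq_sym => /mnm_neq0 [i ai].
  have /(congr1 (mcoeff (a - U_(i))%MM)) := dP i; rewrite mcoeff0 mcoeff_deriv submK ?lep1mP //.
  by move/eqP; rewrite -mulr_natr mulf_eq0 (negbTE (natr_neq0_char0 _)) // orbF => /eqP.
by rewrite PC -meval_origin P0 mpolyC0.
Qed.

Lemma meval_inj_char0 k (P Q : {mpoly K[k]}) : (forall y, P.@[y] = Q.@[y]) -> P = Q.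
Proof.
move=> h; apply/eqP; rewrite -subr_eq0; apply/eqP/meval_eq0_char0 => y.
by rewrite mevalB h subrr.
Qed.

Lemma horner_inj_char0 (p q : {poly K}) : (forall t, p.[t] = q.[t]) -> p = q.
Proof.
move=> h; apply/eqP; rewrite -subr_eq0; apply/eqP/(poly0_char0 charK) => t.
by rewrite hornerD hornerN h subrr.
Qed.

End Polynomials.

(** * Rank one perturbations and first order expansions of determinants *)

Section Determinants.
Variable K : fieldType.

(** [M + t c r] is the Schur complement of the corner 1 in a bordered matrix whose first row
    [(1, -t r)] equals [(1, 0) + t (0, -r)]; the determinant is linear in that row. *)
Lemma det_rank1_affine k (M : 'M[K]_k) (c : 'cV[K]_k) (r : 'rV[K]_k) t :
  \det (M + t *: (c *m r)) =
  \det M + t * \det (block_mx (0 : 'M_1) (- r) c M).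
Proof.
have -> : \det (M + t *: (c *m r)) = \det (block_mx (1%:M : 'M_1) (- (t *: r)) c M).
  have -> : block_mx (1%:M : 'M_1) (- (t *: r)) c M =
      block_mx 1%:M 0 c 1%:M *m
      block_mx 1%:M (- (t *: r)) 0 (M + t *: (c *m r)).
    rewrite mulmx_block !mul1mx !mul0mx !addr0 mulmx1 mulmxN -scalemxAr.
    by rewrite addrCA addNr addr0.
  by rewrite det_mulmx det_lblock det_ublock !det1 !mul1r.
have -> : \det M = \det (block_mx (1%:M : 'M_1) 0 c M).
  by rewrite det_lblock det1 mul1r.
rewrite -[\det (block_mx 1%:M 0 c M)]mul1r.
apply: (@determinant_multilinear _ _ _ _ _ (lshift k ord0)).
- rewrite !rowKu /= !row_row_mx !linear0 scale1r scale_row_mx add_row_mx scaler0 addr0.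
  by congr row_mx; apply/rowP=> i; rewrite !mxE add0r mulrN.
- apply/matrixP=> i j; rewrite !mxE; case: split_ordP => [a /eqP|b].
    by rewrite [a]ord1 eq_sym (negbTE (neq_lift _ _)).
  by move=> _; rewrite !mxE.
- apply/matrixP=> i j; rewrite !mxE; case: split_ordP => [a /eqP|b].
    by rewrite [a]ord1 eq_sym (negbTE (neq_lift _ _)).
  by move=> _; rewrite !mxE.
Qed.

(** Congruence modulo ['X^2], which is all that a derivative at 0 can see. *)
Definition jet_eq (p q : {poly K}) : Prop :=
  p.[0] = q.[0] /\ p^`().[0] = q^`().[0].

Lemma jet_eqD p q p' q' : jet_eq p p' -> jet_eq q q' -> jet_eq (p + q) (p' + q').
Proof. by move=> [h1 h2] [h3 h4]; rewrite /jet_eq !derivD !hornerD h1 h2 h3 h4. Qed.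

Lemma jet_eqM p q p' q' : jet_eq p p' -> jet_eq q q' -> jet_eq (p * q) (p' * q').
Proof.
by move=> [h1 h2] [h3 h4]; rewrite /jet_eq !derivM !(hornerD, hornerM) h1 h2 h3 h4.
Qed.

Lemma jet_eq_det k (M M' : 'M[{poly K}]_k) :
  (forall i j, jet_eq (M i j) (M' i j)) -> jet_eq (\det M) (\det M').
Proof.
move=> h; rewrite /determinant; elim/big_ind2: _ => // [*|s _]; first exact: jet_eqD.
apply: jet_eqM => //; elim/big_ind2: _ => // *; exact: jet_eqM.
Qed.

Lemma jet_eq_mmap k (u u' : 'I_k -> {poly K}) P :
  (forall i, jet_eq (u i) (u' i)) ->
  jet_eq (mmap (@polyC K) u P) (mmap (@polyC K) u' P).
Proof.
move=> h; have e Q : (mmap (@polyC K) u Q).[0] = (mmap (@polyC K) u' Q).[0].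
  by rewrite !horner_mmap; apply: meval_eq => i; case: (h i).
split=> //; rewrite !deriv_mmap !horner_sum; apply: eq_bigr => i _.
by rewrite !hornerM e; case: (h i) => _ ->.
Qed.

Definition one_subX k (N : 'M[K]_k) : 'M[{poly K}]_k :=
  1%:M - 'X *: map_mx polyC N.

Lemma horner_det_one_subX k (N : 'M[K]_k) t :
  (\det (one_subX N)).[t] = \det (1%:M - t *: N).
Proof.
rewrite -[LHS]/(horner_eval t _) -det_map_mx; congr (\det _).
apply/matrixP=> i j; rewrite !mxE /= /horner_eval hornerD hornerN hornerM hornerX hornerC.
by rewrite -polyC_natr hornerC.
Qed.

Lemma det_one_subX0 k (N : 'M[K]_k) : (\det (one_subX N)).[0] = 1.
Proof. by rewrite horner_det_one_subX scale0r subr0 det1. Qed.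

(** A permutation [s] moving [i] also moves [s i], so its Leibniz term is divisible by ['X^2]; only
    the identity contributes to first order. *)
Lemma deriv_det_one_subX k (N : 'M[K]_k) : (\det (one_subX N))^`().[0] = - \tr N.
Proof.
have E i j : one_subX N i j = (i == j)%:R - 'X * (N i j)%:P by rewrite !mxE.
rewrite /determinant linear_sum /= horner_sum (bigD1 (1%g : 'S_k)) //= odd_perm1 mul1r.
rewrite [X in _ + X]big1 ?addr0 => [|s s1].
  rewrite -sumrN.
  suff [] : (\prod_i one_subX N i ((1 : 'S_k)%g i)).[0] = 1 /\
    (\prod_i one_subX N i ((1 : 'S_k)%g i))^`().[0] = \sum_i - N i i by [].
  elim/big_rec2: _ => [|i a p _ [p0 p1]]; first by rewrite derivC horner0 hornerC.
  rewrite perm1 E eqxx derivM derivB derivM derivX derivC !hornerE p0 p1 mulr1 subr0 mul1r.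
  by rewrite mulr1.
have [i si] : exists i, s i != i.
  apply/existsP; apply: contraR s1; rewrite negb_exists => /forallP h.
  by apply/eqP/permP=> i; rewrite perm1; apply/eqP; rewrite -[_ == _]negbK.
have ssi : s (s i) != s i by rewrite (inj_eq perm_inj).
rewrite (bigD1 i) //= (bigD1 (s i)) //= !E [i == _]eq_sym (negbTE si) [s i == _]eq_sym (negbTE ssi).
rewrite !sub0r !derivM !derivN !derivM derivX !hornerE /=.
by rewrite !(oppr0, mul0r, mulr0, addr0).
Qed.

End Determinants.

(** * Linear functionals on polynomials of bounded degree as combinations of values *)

Section Interpolation.
Variable K : fieldType.

Definition deriv_at (x : K) (g : {poly K}) : K^o := g^`().[x].

Fact deriv_at_linear x : linear (deriv_at x).
Proof. by move=> a g h; rewrite /deriv_at derivD derivZ hornerD hornerZ. Qed.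

HB.instance Definition _ x :=
  GRing.isLinear.Build K {poly K} K^o _ (deriv_at x) (deriv_at_linear x).

(** Applies [psi] to the Lagrange expansion of [g]. For [psi] a derivative, this turns infinitesimal
    operators into finite combinations of translations. *)
Lemma interpolation d (x : nat -> K) (psi : {linear {poly K} -> K^o}) :
  injective x -> exists alpha : 'I_d.+1 -> K,
    forall g : {poly K}, (size g <= d.+1)%N ->
      psi g = \sum_i alpha i * g.[x i].
Proof.
move=> x_inj; exists (fun i => psi (tnth (lagrange d.+1 x) i : {poly K})) => g sg.
rewrite {1}(lagrange_gen (ltn0Sn d) x_inj sg) linear_sum /=; apply: eq_bigr => i _.
by rewrite mul_polyC linearZ mulrC.
Qed.

End Interpolation.

(** * Sections of O(d) *)

Section Sections.
Variables (K : fieldType) (m n d : nat).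
Local Notation N := #|{: {ffun 'I_m -> 'I_(m + n)}}|.
Implicit Types (s : H0 K m n d) (A B : frame K m n) (Y : 'M[K]_(n, m)).

Lemma frame_of_plucker (A : 'M[K]_(m + n, m)) k : plucker A k != 0 -> \rank A == m.
Proof.
rewrite /plucker -unitfE -unitmxE -row_full_unit => /eqP h.
by rewrite eqn_leq rank_leq_col /= -{1}h rowsubE mxrankM_maxr.
Qed.

Lemma plucker_mulr (A : 'M[K]_(m + n, m)) g k :
  plucker (A *m g) k = \det g * plucker A k.
Proof.
rewrite /plucker mulrC -det_mulmx; congr (\det _).
by apply/matrixP=> i j; rewrite !mxE; apply: eq_bigr => l _; rewrite !mxE.
Qed.

(** A change of frame multiplies every Plücker coordinate by [\det g], and the fraction [P / L ^ e]
    expressing [s] is homogeneous of degree [d]. *)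
Lemma section_mulr s A B g : val B = val A *m g -> s B = \det g ^+ d * s A.
Proof.
move=> hB; have [k kB] := frame_plucker B.
have hX : ('X_k : {mpoly K[N]}) \is 1.-homog by rewrite dhomogX /= mdeg1.
have [e [P [hP sE]]] := H0P s hX.
have := kB; rewrite hB plucker_mulr mulf_eq0 negb_or => /andP[g0 kA].
rewrite !sE ?mevalXU // (_ : P.@[plucker (val B)] =
    \det g ^+ (d + e) * P.@[plucker (val A)]); last first.
  rewrite -(meval_homogZ _ _ hP); apply: meval_eq => i; by rewrite hB plucker_mulr.
rewrite hB plucker_mulr exprMn exprD; field.
by rewrite expf_neq0 // expf_neq0.
Qed.

Definition cellmx Y : 'M[K]_(m + n, m) := col_mx 1%:M Y.

(** The minor on the first [m] rows; it is 1 on the big cell and serves there as the denominator of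
    sections. *)
Definition idx0 : 'I_N := enum_rank [ffun i : 'I_m => lshift n i].

(** These minors make the affine coordinates of the big cell available as Plücker coordinates. *)
Definition idx (i : 'I_n) (j : 'I_m) : 'I_N :=
  enum_rank [ffun r : 'I_m => if r == j then rshift m i else lshift n r].

Lemma plucker_idx0 (a : 'M[K]_m) Y : plucker (col_mx a Y) idx0 = \det a.
Proof.
rewrite /plucker enum_rankK; congr (\det _); apply/matrixP=> i j.
by rewrite mxE ffunE col_mxEu.
Qed.

Lemma plucker_cell_idx Y i j : plucker (cellmx Y) (idx i j) = Y i j.
Proof.
rewrite /plucker /cellmx enum_rankK; set M := rowsub _ _.
have E a b : M a b = if a == j then Y i b else (a == b)%:R.
  rewrite /M [LHS]mxE ffunE; case: ifP => _; first by rewrite col_mxEd.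
  by rewrite col_mxEu mxE.
rewrite (expand_det_row _ j) (bigD1 j) //= big1 ?addr0.
  rewrite E eqxx /cofactor (_ : row' _ _ = 1%:M); last first.
    apply/matrixP=> a b; rewrite [LHS]mxE [LHS]mxE E eq_sym (negbTE (neq_lift _ _)) mxE.
    by rewrite (inj_eq lift_inj).
  by rewrite det1 addnn -signr_odd odd_double expr0 !mulr1.
(* For [k != j], the minor without row [j] and column [k] contains row [k] of the identity with its
   only nonzero entry removed. *)
move=> k kj; have [k' kE _] := unlift_some (negbT (etrans (eq_sym _ _) (negbTE kj))).
rewrite /cofactor (expand_det_row _ k') big1 ?mulr0 // => l _.
by rewrite [X in X * _]mxE [X in X * _]mxE E -kE (negbTE kj) (negbTE (neq_lift k l)) mul0r.
Qed.

Fact cell_subproof Y : \rank (cellmx Y) == m.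
Proof. by apply: (@frame_of_plucker _ idx0); rewrite plucker_idx0 det1 oner_eq0. Qed.

Definition cell Y : frame K m n := exist (fun M => \rank M == m) _ (cell_subproof Y).

Definition plucker_line (A E : 'M[K]_(m + n, m)) (k : 'I_N) : {poly K} :=
  \det (rowsub (enum_val k) (map_mx polyC A + 'X *: map_mx polyC E)).

Lemma horner_plucker_line (A E : 'M[K]_(m + n, m)) k t : (plucker_line A E k).[t] = plucker (A + t *: E) k.
Proof.
rewrite -[LHS]/(horner_eval t _) -det_map_mx; congr (\det _).
by apply/matrixP=> i j; rewrite !mxE /= /horner_eval hornerD hornerM hornerX !hornerC.
Qed.

Lemma section_mulr_eq0 s A B g : val B = val A *m g -> s A = 0 -> s B = 0.
Proof.
move=> hB sA; rewrite (section_mulr s hB) sA; case: d => [|e]; last by rewrite mulr0.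
by rewrite mulr0.
Qed.

Hypothesis charK : [pchar K] =i pred0.

(** Density of the big cell: on the line [A + t [1; 0]] the top block [t + a] is invertible for
    almost all [t], so the numerator of [s] vanishes identically in [t], in particular at
    [t = 0]. *)
Lemma section_eq0 s : (forall Y, s (cell Y) = 0) -> s = 0.
Proof.
move=> s0; apply/val_inj/funext => A /=; rewrite -[RHS]/(0 : K).
have [k kA] := frame_plucker A.
have hX : ('X_k : {mpoly K[N]}) \is 1.-homog by rewrite dhomogX /= mdeg1.
have [e [P [hP sE]]] := H0P s hX.
pose a := usubmx (val A); pose b := dsubmx (val A).
pose E : 'M[K]_(m + n, m) := col_mx 1%:M 0; pose U := plucker_line (val A) E.
have AE t : val A + t *: E = col_mx (t%:M + a) b.
  rewrite -[val A]vsubmxK scale_col_mx add_col_mx scaler0 addr0 addrC.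
  by rewrite scale_scalar_mx mulr1.
have chiE t : (char_poly (- a)).[t] = \det (t%:M + a).
  rewrite -[LHS]/(horner_eval t _) -det_map_mx; congr (\det _).
  apply/matrixP=> i j.
  by rewrite !mxE /= /horner_eval hornerD hornerN hornerMn hornerX hornerC opprK.
(* The factors [char_poly (- a)] and [U k] absorb the values of [t] where the top block is singular
   or the fraction is undefined. *)
have : mmap polyC U P * (char_poly (- a) * U k) = 0.
  apply: (poly0_char0 charK) => t; rewrite !hornerM chiE.
  have [->|dt] := eqVneq (\det (t%:M + a)) 0; first by rewrite mul0r mulr0.
  have [->|ut] := eqVneq (U k).[t] 0; first by rewrite !mulr0.
  move: ut; rewrite /U horner_plucker_line => ut.
  pose B : frame K m n := exist (fun M => \rank M == m) _ (frame_of_plucker ut).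
  have uA : t%:M + a \in unitmx by rewrite unitmxE unitfE.
  have sB : s B = 0.
    apply: (@section_mulr_eq0 _ (cell (b *m invmx (t%:M + a))) _ (t%:M + a)) => //.
    by rewrite /= AE mul_col_mx mul1mx mulmxKV.
  have := sE B; rewrite mevalXU sB => /(_ ut) /esym/eqP.
  rewrite mulf_eq0 invr_eq0 (negbTE (expf_neq0 _ ut)) orbF => /eqP PB.
  have -> : (mmap polyC U P).[t] = 0; last by rewrite mul0r.
  by rewrite horner_mmap -PB; apply: meval_eq => i; rewrite horner_plucker_line.
move/eqP; rewrite !mulf_eq0 (negbTE (monic_neq0 (char_poly_monic _))) /=.
have U0 i : (U i).[0] = plucker (val A) i by rewrite horner_plucker_line scale0r addr0.
case/orP=> /eqP z; last by case/eqP: kA; rewrite -U0 z horner0.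
rewrite sE ?mevalXU //; have -> : P.@[plucker (val A)] = 0; last by rewrite mul0r.
rewrite -(@horner0 K 0) -z horner_mmap; apply: meval_eq => i; by rewrite U0.
Qed.

Lemma section_inj s s' : (forall Y, s (cell Y) = s' (cell Y)) -> s = s'.
Proof.
move=> h; apply/eqP; rewrite -subr_eq0; apply/eqP/section_eq0 => Y.
by rewrite -[LHS]/(s (cell Y) - s' (cell Y)) h subrr.
Qed.

Lemma size_mmap_homog k e (u : 'I_k -> {poly K}) (P : {mpoly K[k]}) :
  P \is e.-homog -> (forall i, size (u i) <= 2)%N ->
  (size (mmap (@polyC K) u P) <= e.+1)%N.
Proof.
move=> /dhomogP hP hu; rewrite /mmap big_seq.
apply: (big_ind (fun p : {poly K} => size p <= e.+1)%N) => [|p q hp hq|a /hP /= ha].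
- by rewrite size_poly0.
- by rewrite (leq_trans (size_polyD _ _)) // geq_max hp.
rewrite mul_polyC (leq_trans (size_scale_leq _ _)) // -ha mdegE.
apply: (big_rec2 (fun (p : {poly K}) f => size p <= f.+1)%N) => [|i p f _ hp]; first by rewrite size_polyC oner_eq0.
rewrite (leq_trans (size_polyMleq _ _)) //.
have hi : (size (u i ^+ a i) <= (a i).+1)%N.
  rewrite (leq_trans (size_poly_exp_leq _ _)) // ltnS -[X in (_ <= X)%N]mul1n.
  by rewrite leq_mul2r -subn1 leq_subLR hu orbT.
by rewrite -subn1 leq_subLR add1n -addSn -addnS; exact: leq_add.
Qed.

(* The Plücker coordinates of A + t c r are affine in t; a linear form taking
   the values 1 and 0 on the two coefficients makes the section polynomial in t,
   the one taking the values 0 and 1 bounds its degree. *)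
Lemma section_line s (A : 'M[K]_(m + n, m)) (c : 'cV_(m + n)) (r : 'rV_m) :
  (forall t, \rank (A + t *: (c *m r))%R == m) ->
  exists2 g : {poly K}, (size g <= d.+1)%N &
    forall t B, val B = A + t *: (c *m r) -> s B = g.[t].
Proof.
move=> hr; pose B t : frame K m n := exist (fun M => \rank M == m) _ (hr t).
pose u0 := plucker A.
pose u1 (k : 'I_N) := \det (block_mx (0 : 'M_1) (- r) (rowsub (enum_val k) c) (rowsub (enum_val k) A)).
have uE t k : plucker (val (B t)) k = u0 k + t * u1 k.
  rewrite /plucker /= -det_rank1_affine; congr (\det _).
  by apply/matrixP=> i j; rewrite !mxE; congr (_ + _ * _); apply: eq_bigr => l _; rewrite !mxE.
suff [g sg gE] : exists2 g : {poly K}, (size g <= d.+1)%N & forall t, s (B t) = g.[t].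
  exists g => // t B' hB'; rewrite -gE; congr (s _); exact/val_inj.
pose u (k : 'I_N) : {poly K} := (u0 k)%:P + u1 k *: 'X.
have su k : (size (u k) <= 2)%N.
  rewrite (leq_trans (size_polyD _ _)) // geq_max (leq_trans (size_polyC_leq1 _)) //=.
  by rewrite (leq_trans (size_scale_leq _ _)) // size_polyX.
have huE P t : (mmap polyC u P).[t] = P.@[plucker (val (B t))].
  rewrite horner_mmap; apply: meval_eq => k.
  by rewrite uE hornerD hornerC hornerZ hornerX mulrC.
have [k kA] : exists k, u0 k != 0.
  by have [k] := frame_plucker (B 0); rewrite uE mul0r addr0; exists k.
case: (pselect (exists k', u0 k * u1 k' - u1 k * u0 k' != 0)) => [[k' D0]|h].
  set D := _ - _ in D0.
  pose form a b : {mpoly K[N]} := a *: 'X_k + b *: 'X_k'.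
  have hform a b : form a b \is 1.-homog by rewrite rpredD // rpredZ // dhomogX /= mdeg1.
  have formE a b t : (form a b).@[plucker (val (B t))] =
      a * (u0 k + t * u1 k) + b * (u0 k' + t * u1 k').
    by rewrite mevalD !mevalZ !mevalXU !uE.
  have [e [P [hP sP]]] := H0P s (hform (u1 k' / D) (- u1 k / D)).
  have [f [Q [hQ sQ]]] := H0P s (hform (- u0 k' / D) (u0 k / D)).
  have gE t : s (B t) = (mmap polyC u P).[t].
    have E : (form (u1 k' / D) (- u1 k / D)).@[plucker (val (B t))] = 1.
      by rewrite formE /D; field.
    by rewrite sP E ?oner_neq0 // expr1n divr1 huE.
  (* The second form takes the value [t], so [s] is also [Q / t ^ f] with [Q] of degree at most
     [d + f]; the extra factor ['X] settles [t = 0]. *)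
  have pq : mmap polyC u P * 'X^(f.+1) = mmap polyC u Q * 'X.
    apply: (horner_inj_char0 charK) => t.
    rewrite !hornerM -gE hornerXn hornerX; have [->|t0] := eqVneq t 0.
      by rewrite expr0n !mulr0.
    have E : (form (- u0 k' / D) (u0 k / D)).@[plucker (val (B t))] = t.
      by rewrite formE /D; field.
    by rewrite sQ E // huE exprS; field; rewrite expf_neq0.
  exists (mmap polyC u P) => //; have [->|p0] := eqVneq (mmap polyC u P) 0; first by rewrite size_poly0.
  have sq := size_mmap_homog hQ su.
  have := congr1 (fun p : {poly K} => size p) pq.
  have q0 : mmap polyC u Q != 0.
    apply: contraNneq p0 => q0; move/eqP: pq; rewrite q0 mul0r mulf_eq0.
    by rewrite (negbTE (monic_neq0 (monicXn _ _))) orbF.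
  rewrite /= size_mulXn // size_mulX // => sE.
  by rewrite -(leq_add2l f.+1) [leqLHS]sE addSn addnS ltnS [(f + d)%N]addnC.
(* In the remaining case [u1] is a multiple of [u0]. It is 0, as otherwise all Plücker coordinates
   of the frame [B t] would vanish at [t = - u0 k / u1 k]. So [s] is constant on the line. *)
have u10 k' : u1 k' = 0.
  have hk j : u0 k * u1 j = u1 k * u0 j.
    apply/eqP; rewrite -subr_eq0; apply/negPn/negP => z; apply: h; by exists j.
  have [z|nz] := eqVneq (u1 k) 0.
    by have /eqP := hk k'; rewrite z mul0r mulf_eq0 (negbTE kA) => /eqP.
  have [j] := frame_plucker (B (- (u0 k / u1 k))); rewrite uE => /eqP[].
  have -> : u1 j = u1 k * u0 j / u0 k by rewrite -hk mulrC mulKf.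
  by field; rewrite nz kA.
exists (s (B 0))%:P; first by rewrite (leq_trans (size_polyC_leq1 _)).
move=> t; rewrite hornerC.
have hX : ('X_k : {mpoly K[N]}) \is 1.-homog by rewrite dhomogX /= mdeg1.
have [e [P [hP sE]]] := H0P s hX.
have e1 j t' : plucker (val (B t')) j = u0 j by rewrite uE u10 mulr0 addr0.
rewrite !sE ?mevalXU ?e1 //; congr (_ / _); apply: meval_eq => j; by rewrite !e1.
Qed.

End Sections.

(** * The action in the big cell *)

Section LieDerivative.
Variables (K : fieldType) (charK : [pchar K] =i pred0) (m n d : nat).
Local Notation N := #|{: {ffun 'I_m -> 'I_(m + n)}}|.
Implicit Types (s : H0 K m n d) (Y : 'M[K]_(n, m)).

Lemma Lie_act_polynomial x s (A : frame K m n) (g : {poly K}) :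
  (forall t (B : frame K m n), val B = (1%:M - t *: x) *m val A -> s B = g.[t]) ->
  Lie_act d x s A = g^`().[0].
Proof.
move=> gE; apply: (is_derivative_uniq charK (Lie_actP x charK s A)).
exists g, 1; split; first by rewrite hornerC oner_neq0.
  by move=> t B hB _; rewrite hornerC divr1 (gE t).
by rewrite derivC !hornerC mulr1 mulr0 subr0 expr1n divr1.
Qed.

(** Modulo [t^2], [(1 - t x) A] is [(A + t E) (1 - t Z)]: the motion splits into a displacement [E]
    and a change of frame, which only contributes a determinant. *)
Lemma curve_jet (A : 'M[K]_(m + n, m)) x E Z k : - (x *m A) = E - A *m Z ->
  jet_eq (curve x A k) (plucker_line A E k * \det (one_subX Z)).
Proof.
move=> hE; have -> : curve x A k = plucker_line A (- (x *m A)) k.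
  apply: (horner_inj_char0 charK) => t.
  by rewrite horner_curve horner_plucker_line mulmxBl mul1mx scalerN scalemxAl.
rewrite /plucker_line -det_mulmx mul_rowsub_mx.
apply: jet_eq_det => i j; rewrite [X in jet_eq X _]mxE [X in jet_eq _ X]mxE.
move: (enum_val k i) => {}i; rewrite hE.
have EE i' j' (M : 'M[K]_(m + n, m)) : (map_mx polyC A + 'X *: map_mx polyC M) i' j' =
    (A i' j')%:P + 'X * (M i' j')%:P by rewrite !mxE.
rewrite EE [X in jet_eq _ X]mxE.
under [X in jet_eq _ X]eq_bigr => l _ do rewrite EE [one_subX _ _ _]mxE !mxE -polyC_natr.
split.
  rewrite !hornerE horner_sum /= (bigD1 j) //= big1 ?addr0 => [|l lj].
    by rewrite !hornerE subr0 eqxx mulr1.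
  by rewrite !hornerE subr0 (negbTE lj) mulr0.
rewrite linear_sum horner_sum /= derivD derivM derivX !derivC !hornerE !mxE.
have -> : E i j = \sum_l E i l * (l == j)%:R.
  by rewrite (bigD1 j) //= eqxx mulr1 big1 ?addr0 // => l /negbTE ->; rewrite mulr0.
rewrite -sumrB; apply: eq_bigr => l _.
rewrite derivM derivB derivD !derivM derivX !derivC !hornerE /=; ring.
Qed.

(** The trace pairing [tr (X^T Y)], through which matrices represent linear forms on matrices. *)
Definition mxdot (X Y : 'M[K]_(n, m)) : K^o := \sum_i \sum_j X i j * Y i j.

Lemma mxdot_linear X : linear (mxdot X).
Proof.
move=> a Y Z; rewrite -[RHS]/(a * mxdot X Y + mxdot X Z) /mxdot mulr_sumr -big_split /=.
apply: eq_bigr => i _; rewrite mulr_sumr -big_split /=; apply: eq_bigr => j _.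
by rewrite !mxE; ring.
Qed.

HB.instance Definition _ X :=
  GRing.isLinear.Build K 'M[K]_(n, m) K^o _ (mxdot X) (mxdot_linear X).

End LieDerivative.

(** * Sections as polynomials on the big cell *)

Section Chart.
Variables (K : fieldType) (charK : [pchar K] =i pred0) (m n d D : nat).
Local Notation N := #|{: {ffun 'I_m -> 'I_(m + n)}}|.
Implicit Types (s : H0 K m n d) (Y : 'M[K]_(n, m)).

(* b is a basis of the n x m matrices and cb its dual basis. *)
Variables b cb : 'I_D -> 'M[K]_(n, m).

Definition dual_bases : Prop :=
  (forall Y, \sum_i mxdot (cb i) Y *: b i = Y) /\
  (forall i j, mxdot (cb i) (b j) = (i == j)%:R).

Definition point (y : 'I_D -> K) : 'M[K]_(n, m) := \sum_i y i *: b i.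

Definition gen_plucker (k : 'I_N) : {mpoly K[D]} :=
  \det (rowsub (enum_val k)
    (col_mx 1%:M (\sum_i 'X_i *: map_mx (@mpolyC D K) (b i)) : 'M_(m + n, m))).

Lemma meval_gen_plucker y k : (gen_plucker k).@[y] = plucker (cellmx (point y)) k.
Proof.
rewrite -det_map_mx; congr (\det _); apply/matrixP=> i j.
rewrite !mxE /=; case: fintype.split => r.
  by rewrite !mxE rmorph_nat.
rewrite !summxE rmorph_sum /=; apply: eq_bigr => l _.
by rewrite !mxE mevalM mevalXU mevalC.
Qed.

(** The coordinate [idx0] is 1 on the cell, so the fraction giving [s] there reduces to its
    numerator. *)
Lemma ex_chart s : exists f : {mpoly K[D]}, forall y, f.@[y] = s (cell (point y)).
Proof.
have hX : ('X_(idx0 m n) : {mpoly K[N]}) \is 1.-homog by rewrite dhomogX /= mdeg1.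
have [e [P [hP sE]]] := H0P s hX.
exists (P \mPo [tuple gen_plucker k | k < N]) => y; rewrite comp_mpoly_meval sE.
  rewrite mevalXU plucker_idx0 det1 expr1n divr1; apply: meval_eq => k.
  by rewrite tnth_mktuple meval_gen_plucker.
by rewrite mevalXU plucker_idx0 det1 oner_neq0.
Qed.

Definition chart s : {mpoly K[D]} := projT1 (cid (ex_chart s)).

Lemma chartE s y : (chart s).@[y] = s (cell (point y)).
Proof. exact: projT2 (cid (ex_chart s)) y. Qed.

Lemma chart_unique s f : (forall y, f.@[y] = s (cell (point y))) -> chart s = f.
Proof. by move=> h; apply: (meval_inj_char0 charK) => y; rewrite chartE h. Qed.

Lemma chart_linear : linear chart.
Proof.
move=> a s t; apply: chart_unique => y.
by rewrite mevalD mevalZ !chartE.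
Qed.

HB.instance Definition _ :=
  GRing.isLinear.Build K (H0 K m n d) {mpoly K[D]} _ chart chart_linear.

Hypothesis b_dual : dual_bases.

Definition coord Y i : K^o := mxdot (cb i) Y.

Lemma coordK Y : point (coord Y) = Y.
Proof. exact: b_dual.1. Qed.

Lemma pointK y i : coord (point y) i = y i.
Proof.
rewrite /coord /point linear_sum /= (bigD1 i) //= big1 ?addr0 => [|j ji].
  by rewrite linearZ /= b_dual.2 eqxx [LHS]mulr1.
by rewrite linearZ /= b_dual.2 eq_sym (negbTE ji) [LHS]mulr0.
Qed.

Lemma chart_cell s Y : s (cell Y) = (chart s).@[coord Y].
Proof. by rewrite chartE coordK. Qed.

Lemma chart_inj : injective chart.
Proof.
by move=> s t h; apply: (section_inj charK) => Y; rewrite !chart_cell h.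
Qed.

(* Modulo t^2, (1 - t x) A equals (A + t [0; w]) (1 - t Z), where A = [1; Y]. *)
Lemma Lie_act_cell s (p : 'M[K]_m) (q : 'M[K]_(m, n)) (r : 'M[K]_(n, m)) (u : 'M[K]_n) y :
  let Y := point y in let Z := p + q *m Y in
  Lie_act d (block_mx p q r u) s (cell Y) =
    - (d%:R * \tr Z) * (chart s).@[y] +
    \sum_i coord (Y *m Z - (r + u *m Y)) i * (chart s)^`M(i).@[y].
Proof.
move=> Y Z; set w := Y *m Z - _; set x := block_mx _ _ _ _.
have hX : ('X_(idx0 m n) : {mpoly K[N]}) \is 1.-homog by rewrite dhomogX /= mdeg1.
have [e [P [hP sE]]] := H0P s hX.
pose A := cellmx Y; pose E : 'M[K]_(m + n, m) := col_mx 0 w.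
have jet k : jet_eq (curve x A k) (plucker_line A E k * \det (one_subX Z)).
  apply: (curve_jet charK).
  rewrite /A /cellmx mul_block_col mul_col_mx opp_col_mx opp_col_mx add_col_mx !mulmx1 mul1mx add0r.
  by rewrite /w addrAC subrr !add0r.
pose delta := \det (one_subX Z).
pose v := plucker_line A E; pose g := mmap (@polyC K) (fun i => (y i)%:P + coord w i *: 'X) (chart s).
have vE : mmap (@polyC K) v P = g.
  apply: (horner_inj_char0 charK) => t; rewrite !horner_mmap.
  transitivity (P.@[plucker (cellmx (Y + t *: w))]).
    apply: meval_eq => k; rewrite horner_plucker_line /A /E /cellmx scale_col_mx add_col_mx.
    by rewrite scaler0 addr0.
  have := sE (cell (Y + t *: w)).
  rewrite mevalXU plucker_idx0 det1 expr1n divr1 => /(_ (oner_neq0 _)) <-.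
  rewrite chart_cell; apply: meval_eq => i.
  by rewrite /coord linearD linearZ /= -/(coord _ i) pointK hornerD hornerC hornerZ hornerX mulrC.
have v0 : v (idx0 m n) = 1.
  apply: (horner_inj_char0 charK) => t; rewrite horner_plucker_line hornerC.
  by rewrite /A /E /cellmx scale_col_mx add_col_mx scaler0 addr0 plucker_idx0 det1.
(* The extra factor ['X_(idx0 m n)] makes the denominator a positive power, so that its nonvanishing
   ensures that of the coordinate even when [e = 0]. *)
pose num := mmap (@polyC K) (curve x A) (P * 'X_(idx0 m n)).
pose den := mmap (@polyC K) (curve x A) ('X_(idx0 m n) ^+ e.+1).
have mmapE Q f : Q \is f.-homog ->
    jet_eq (mmap (@polyC K) (curve x A) Q) (delta ^+ f * mmap (@polyC K) v Q).
  move=> hQ.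
  have -> : delta ^+ f * mmap (@polyC K) v Q =
      mmap (@polyC K) (fun k => v k * delta) Q.
    apply: (horner_inj_char0 charK) => t; rewrite hornerM horner_exp !horner_mmap.
    by rewrite -meval_homogZ //; apply: meval_eq => k; rewrite hornerM mulrC.
  exact: jet_eq_mmap.
(* To first order [num / den] is [delta ^+ d * g]; the power of [delta] produces the term
   [- d * \tr Z], and [g] the directional derivative along [w]. *)
have [n0 n1] : jet_eq num (delta ^+ (d + e).+1 * g).
  have := mmapE (P * 'X_(idx0 m n)) (d + e).+1.
  have -> : mmap (@polyC K) v (P * 'X_(idx0 m n)) = g.
    by rewrite rmorphM /= vE mmapX mmap1U v0 mulr1.
  rewrite -addn1; apply.
  exact: dhomogM.
have [d0 d1] : jet_eq den (delta ^+ e.+1).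
  have := mmapE ('X_(idx0 m n) ^+ e.+1) e.+1.
  have -> : mmap (@polyC K) v ('X_(idx0 m n) ^+ e.+1) = 1.
    by rewrite rmorphXn /= mmapX mmap1U v0 expr1n.
  rewrite mulr1; apply.
  by rewrite -[X in X.-homog]mul1n dhomogMn.
have delta0 : delta.[0] = 1 by rewrite det_one_subX0.
have pl0 Q : (mmap (@polyC K) (curve x A) Q).[0] = Q.@[plucker A].
  by rewrite horner_mmap; apply: meval_eq => k; rewrite horner_curve0.
have g0 : g.[0] = (chart s).@[y].
  rewrite horner_mmap; apply: meval_eq => i.
  by rewrite hornerD hornerC hornerZ hornerX mulr0 addr0.
have g1 : g^`().[0] = \sum_i coord w i * (chart s)^`M(i).@[y].
  rewrite deriv_mmap horner_sum; apply: eq_bigr => i _.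
  rewrite hornerM horner_mmap derivD derivC derivZ derivX add0r hornerZ hornerC mulr1 mulrC.
  congr (_ * _); apply: meval_eq => j.
  by rewrite hornerD hornerC hornerZ hornerX mulr0 addr0.
have delta1 : delta^`().[0] = - \tr Z := deriv_det_one_subX Z.
have dn : (delta ^+ e.+1)^`().[0] = e.+1%:R * - \tr Z.
  by rewrite deriv_exp hornerMn hornerM horner_exp delta0 expr1n mulr1 delta1 mulr_natl.
have dn' : (delta ^+ (d + e).+1)^`().[0] = (d + e).+1%:R * - \tr Z.
  by rewrite deriv_exp hornerMn hornerM horner_exp delta0 expr1n mulr1 delta1 mulr_natl.
rewrite (is_derivative_uniq charK (Lie_actP x charK s (cell Y))
  (c2 := (num^`().[0] * den.[0] - num.[0] * den^`().[0]) / den.[0] ^+ 2)).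
  rewrite d0 n0 d1 n1 derivM hornerD !hornerM !horner_exp dn dn' g0 g1 delta0 !expr1n -addnS natrD.
  rewrite divr1; ring.
exists num, den; split=> //.
  by rewrite pl0 rmorphXn /= mevalXU plucker_idx0 det1 expr1n oner_neq0.
move=> t B hB; have EB Q : (mmap (@polyC K) (curve x A) Q).[t] = Q.@[plucker (val B)].
  by rewrite horner_mmap; apply: meval_eq => k; rewrite horner_curve hB.
rewrite !EB rmorphXn mevalM /= mevalXU expf_eq0 /= => L0.
by rewrite sE ?mevalXU // exprS; field; rewrite expf_neq0 ?L0.
Qed.

End Chart.

(** * Taylor coefficients *)

(** Bundles an element of [dual] as a linear map, to make the general linearity lemmas
    applicable. *)
Definition dual_linear (K : fieldType) (M : lmodType K) (phi : dual M) :
    {linear M -> K^o} :=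
  HB.pack (phi : M -> K^o)
    (GRing.isLinear.Build K M K^o _ (phi : M -> K^o) (dualP phi)).

Section Filtration.
Variables (K : fieldType) (charK : [pchar K] =i pred0) (m n d D : nat).
Local Notation N := #|{: {ffun 'I_m -> 'I_(m + n)}}|.
Implicit Types (s : H0 K m n d) (Y : 'M[K]_(n, m)) (phi : dual (H0 K m n d)).
Variables b cb : 'I_D -> 'M[K]_(n, m).
Hypothesis b_dual : dual_bases b cb.
Local Notation chart := (chart b).

Lemma polynomial_section (Q : {mpoly K[N]}) : Q \is d.-homog ->
  exists s, forall A, s A = Q.@[plucker (val A)].
Proof.
move=> hQ.
have hs : (fun A : frame K m n => Q.@[plucker (val A)] : K^o) \in sections d.
  apply/asboolP=> L hL; exists 0%N, Q; rewrite addn0; split=> // A _.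
  by rewrite expr0 divr1.
by exists (MkH0 hs).
Qed.

(** [L i] is a linear form in the Plücker coordinates restricting to the [i]-th coordinate on the
    cell; the monomial is homogenized to degree [d] by a power of the coordinate [idx0]. *)
Lemma ex_section a : (mdeg a <= d)%N -> exists s, chart s = 'X_[a].
Proof.
move=> ad; pose L i : {mpoly K[N]} := \sum_r \sum_c cb i r c *: 'X_(idx r c).
have hL i : L i \is 1.-homog.
  by rewrite rpred_sum // => r _; rewrite rpred_sum // => c _; rewrite rpredZ // dhomogX /= mdeg1.
have hX (P : {mpoly K[N]}) e : P \is 1.-homog -> P ^+ e \is e.-homog.
  by move=> hP; rewrite -[X in X.-homog]mul1n dhomogMn.
pose Q := \prod_i L i ^+ a i * 'X_(idx0 m n) ^+ (d - mdeg a).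
have hQ : Q \is d.-homog.
  rewrite -{1}(subnKC ad); apply: dhomogM; last by apply: hX; rewrite dhomogX /= mdeg1.
  rewrite mdegE; elim/big_rec2: _ => [|i e P _ hP]; first exact: dhomog1.
  by apply: dhomogM => //; exact: hX.
have [s sE] := polynomial_section hQ; exists s; apply: (chart_unique charK) => y.
rewrite sE mevalM rmorphXn /= mevalXU plucker_idx0 det1 expr1n mulr1 mevalX rmorph_prod /=.
apply: eq_bigr => i _; rewrite rmorphXn /= -{1}(pointK b_dual y i); congr (_ ^+ _).
rewrite /coord /mxdot raddf_sum /=; apply: eq_bigr => r _; rewrite raddf_sum /=.
by apply: eq_bigr => c _; rewrite mevalZ mevalXU plucker_cell_idx.
Qed.

Lemma chart_Lie_lower s i : chart (Lie_act d (block_mx 0 0 (b i) 0) s) = - (chart s)^`M(i).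
Proof.
apply: (chart_unique charK) => y.
rewrite (Lie_act_cell charK b_dual) !(mul0mx, addr0, mulmx0, sub0r).
rewrite mxtrace0 mulr0 oppr0 mul0r add0r (bigD1 i) //= big1 ?addr0 => [|j ji].
  by rewrite /coord [mxdot _ _]linearN /= b_dual.2 eqxx mulN1r mevalN.
by rewrite /coord [mxdot _ _]linearN /= b_dual.2 (negbTE ji) oppr0 mul0r.
Qed.

(** [Lie_act_cell] gives the coefficients pointwise; the closure properties of [ispoly] turn them
    into polynomials independent of [s]. *)
Lemma chart_Lie x : exists (h : {mpoly K[D]}) (w : 'I_D -> {mpoly K[D]}),
  forall s, chart (Lie_act d x s) = h * chart s + \sum_i w i * (chart s)^`M(i).
Proof.
pose ispoly F := exists f : {mpoly K[D]}, forall y, F y = f.@[y].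
have cP (c : K) : ispoly (fun=> c) by exists c%:MP => y; rewrite mevalC.
have aP F G : ispoly F -> ispoly G -> ispoly (fun y => F y + G y).
  by move=> [f fE] [g gE]; exists (f + g) => y; rewrite mevalD fE gE.
have mP F G : ispoly F -> ispoly G -> ispoly (fun y => F y * G y).
  by move=> [f fE] [g gE]; exists (f * g) => y; rewrite mevalM fE gE.
have sP (I : finType) (F : I -> ('I_D -> K) -> K) :
    (forall i, ispoly (F i)) -> ispoly (fun y => \sum_i F i y).
  move=> /choice [f fE]; exists (\sum_i f i) => y; rewrite raddf_sum /=.
  by apply: eq_bigr => i _.
have eP F G : (forall y, F y = G y) -> ispoly G -> ispoly F.
  by move=> e [g gE]; exists g => y; rewrite e.
have ptP i j : ispoly (fun y => point b y i j).
  apply: (eP _ (fun y => \sum_l y l * b l i j)) => [y|].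
    by rewrite summxE; apply: eq_bigr => l _; rewrite mxE.
  by apply: (sP) => l; apply: (mP) => //; exists 'X_l => y; rewrite mevalXU.
pose p := ulsubmx x; pose q := ursubmx x; pose r := dlsubmx x; pose u := drsubmx x.
have mulP k1 k2 k3 (F : ('I_D -> K) -> 'M[K]_(k1, k2)) (G : ('I_D -> K) -> 'M[K]_(k2, k3)) :
    (forall i j, ispoly (fun y => F y i j)) -> (forall i j, ispoly (fun y => G y i j)) ->
    forall i j, ispoly (fun y => (F y *m G y) i j).
  move=> hF hG i j; apply: (eP _ (fun y => \sum_l F y i l * G y l j)) => [y|]; first by rewrite mxE.
  by apply: (sP) => l; apply: (mP).
have addP k1 k2 (F G : ('I_D -> K) -> 'M[K]_(k1, k2)) :
    (forall i j, ispoly (fun y => F y i j)) -> (forall i j, ispoly (fun y => G y i j)) ->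
    forall i j, ispoly (fun y => (F y + G y) i j).
  by move=> hF hG i j; apply: (eP _ (fun y => F y i j + G y i j)) => [y|]; [rewrite mxE | exact: (aP)].
have cstP k1 k2 (M : 'M[K]_(k1, k2)) : forall i j, ispoly (fun y => M i j) by [].
have ZP : forall i j, ispoly (fun y => (p + q *m point b y) i j).
  by apply: (addP) => //; apply: (mulP).
have [h hE] : ispoly (fun y => - (d%:R * \tr (p + q *m point b y))).
  apply: (eP _ (fun y => - d%:R * \tr (p + q *m point b y))) => [y|]; first by rewrite mulNr.
  by apply: (mP) => //; rewrite /mxtrace; apply: (sP).
have wP i : ispoly (fun y => coord cb (point b y *m (p + q *m point b y) - (r + u *m point b y)) i).
  apply: (sP) => k; apply: (sP) => l; apply: (mP) => //; apply: (addP); first exact: (mulP).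
  move=> k' l'; apply: (eP _ (fun y => - 1 * (r + u *m point b y) k' l')) => [y|].
    by rewrite mxE mulN1r.
  by apply: (mP) => //; apply: (addP) => //; apply: (mulP).
have [w wE] := choice wP.
exists h, w => s; apply: (chart_unique charK) => y.
rewrite -[x]submxK (Lie_act_cell charK b_dual) mevalD mevalM -hE; congr (_ + _).
by rewrite raddf_sum /=; apply: eq_bigr => i _; rewrite mevalM -wE.
Qed.

(** Membership in the power [l + 1] of the maximal ideal of the origin. *)
Definition vanishes_to l (f : {mpoly K[D]}) : Prop :=
  forall a, (mdeg a <= l)%N -> f@_a = 0.

Lemma vanishes_toM l f g : vanishes_to l g -> vanishes_to l (f * g).
Proof.
move=> hg a al; rewrite mcoeffM big1 // => k /eqP aE; rewrite [X in _ * X]hg ?mulr0 //.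
by apply: leq_trans al; rewrite [in leqRHS](congr1 mdeg aE) mdegD leq_addl.
Qed.

Lemma vanishes_to_deriv l f i : vanishes_to l.+1 f -> vanishes_to l f^`M(i).
Proof.
by move=> hf a al; rewrite mcoeff_deriv hf ?mul0rn // mdegD mdeg1 addn1.
Qed.

(** The functional factors through the [l]-jet at the origin of the cell. *)
Definition depends_on_jet l phi : Prop :=
  forall s, vanishes_to l (chart s) -> phi s = 0.

Lemma Lie_dualE x phi s : Lie_dual x phi s = - phi (Lie_act d x s).
Proof. by []. Qed.

Lemma depends_on_jetW l k phi : (l <= k)%N -> depends_on_jet l phi -> depends_on_jet k phi.
Proof. by move=> lk h s hs; apply: h => a al; apply: hs; apply: leq_trans lk. Qed.

(** A differential operator of order 1 lowers the order of vanishing by at most one. *)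
Lemma depends_on_jet_Lie x l phi :
  depends_on_jet l phi -> depends_on_jet l.+1 (Lie_dual x phi).
Proof.
move=> hphi s hs; rewrite Lie_dualE hphi ?oppr0 //.
have [h [w ->]] := chart_Lie x; move=> a al.
rewrite mcoeffD (@vanishes_toM l) ?add0r // => [|c cl]; last by apply: hs; apply: leqW.
rewrite raddf_sum big1 // => i _; apply: (@vanishes_toM l) => //.
exact: vanishes_to_deriv.
Qed.

Lemma depends_on_jet_foldr xs phi :
  depends_on_jet 0 phi -> depends_on_jet (size xs) (foldr (@Lie_dual K m n d) phi xs).
Proof. by move=> h; elim: xs => //= x xs IH; exact: depends_on_jet_Lie. Qed.

Local Notation z i := (block_mx 0 0 (b i) 0).

(** The constant stays implicit: only its nonvanishing matters. *)
Definition coef_multiple (phi : dual (H0 K m n d)) a : Prop :=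
  exists2 c : K, c != 0 & forall s, phi s = c * (chart s)@_a.

(** The sign of the dual action cancels that of [chart_Lie_lower], and each derivative contributes a
    positive integer factor, nonzero in characteristic zero. *)
Lemma coef_multiple_lower phi a i k : coef_multiple phi a ->
  coef_multiple (iter k (Lie_dual (z i)) phi) (a + U_(i) *+ k)%MM.
Proof.
move=> h; elim: k => [|k [c c0 cE]]; first by rewrite mulm0n addm0.
exists (c * (((a + U_(i) *+ k)%MM i).+1)%:R); first by rewrite mulf_neq0 // natr_neq0_char0.
move=> s; rewrite iterS Lie_dualE cE chart_Lie_lower mcoeffN mulrN opprK mcoeff_deriv.
by rewrite mulmSr addmA; move: (_@_ _) => X; rewrite -[X *+ _]mulr_natr mulrA mulrAC.
Qed.

Lemma coef_multiple_monomial phi a :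
  coef_multiple phi 0%MM -> coef_multiple (monomial_act (fun i => z i) a phi) a.
Proof.
(* Only the second occurrence of [a] is rewritten, as a sum over [enum 'I_D], so that the induction
   follows the [foldr]. *)
move=> h; have -> : coef_multiple (monomial_act (fun i => z i) a phi) a =
    coef_multiple (monomial_act (fun i => z i) a phi) (\sum_(i <- enum 'I_D) U_(i) *+ a i)%MM.
  by rewrite big_enum -multinomUE_id.
rewrite /monomial_act.
elim: (enum 'I_D) => [|i r IH]; first by rewrite big_nil.
by rewrite big_cons addmC; exact: coef_multiple_lower.
Qed.

Lemma monomial_act_U l a phi : (mdeg a <= l)%N ->
  exists2 xs, (size xs <= l)%N /\ (forall x, x \in xs -> @sl K m n x) &
    monomial_act (fun i => z i) a phi = foldr (@Lie_dual K m n d) phi xs.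
Proof.
move=> al; exists (flatten [seq nseq (a i) (z i) | i <- enum 'I_D]); first split.
- apply: leq_trans al; rewrite size_flatten /shape -map_comp sumnE big_map mdegE big_enum /=.
  by apply: leq_sum => i _; rewrite size_nseq.
- move=> x /flattenP[s /mapP[i _ ->]] /nseqP[-> _].
  by rewrite /sl /= mxtrace_block !mxtrace0 addr0.
rewrite /monomial_act; elim: (enum 'I_D) => //= i r ->.
by rewrite foldr_cat; elim: (a i) => //= k ->.
Qed.

Lemma mcoeff_sumX (I : finType) (c : I -> K) (A : I -> 'X_{1..D}) f :
  (\sum_i c i *: 'X_[A i] : {mpoly K[D]})@_f = \sum_i c i * (A i == f)%:R.
Proof. by rewrite raddf_sum /=; apply: eq_bigr => i _; rewrite mcoeffZ mcoeffX. Qed.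

(** Up to nonzero factors the monomials applied to [v] are the Taylor coefficients of order at most
    [l]; the sections [sig a] with chart ['X_[a]] form a dual family. *)
Lemma monomial_basis l v : (l <= d)%N -> coef_multiple v 0%MM ->
  is_basis (U_orbit l v)
    (fun a : 'X_{1..D < l.+1} => monomial_act (fun i => z i) a v).
Proof.
move=> ld hv.
have hm (a : 'X_{1..D < l.+1}) := coef_multiple_monomial a hv.
(* Here [l <= d] enters: every monomial of degree at most [l] is the chart of a section. *)
have hX (a : 'X_{1..D < l.+1}) : exists s, chart s = 'X_[a].
  by apply: ex_section; rewrite (leq_trans _ ld) // -ltnS bmdeg.
have [sig sigE] := choice hX.
have evE (c : 'X_{1..D < l.+1} -> K) (F : 'X_{1..D < l.+1} -> dual (H0 K m n d)) s :
    (\sum_a c a *: F a) s = \sum_a c a * F a s.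
  by elim/big_ind2: _ => [//|x x' y y' <- <-|].
split=> [c c0 a|].
  have /(congr1 (fun phi : dual (H0 K m n d) => phi (sig a))) := c0.
  rewrite evE (bigD1 a) //= big1 ?addr0 => [|a' a'a].
    have [k k0 kE] := hm a; rewrite kE sigE mcoeffX eqxx mulr1 => /eqP.
    by rewrite -[X in _ == X]/(0 : K) mulf_eq0 (negbTE k0) orbF => /eqP.
  by have [k k0 kE] := hm a'; rewrite kE sigE mcoeffX -bmeqP eq_sym (negbTE a'a) !mulr0.
apply/seteqP; split=> [w [c ->]|_ [u [r [rl ->]] <-]].
  have hU (a : 'X_{1..D < l.+1}) :=
    @monomial_act_U l a v (ltnSE (bmdeg a)).
  have hU' (a : 'X_{1..D < l.+1}) : exists xs, [/\ (size xs <= l)%N,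
    forall x, x \in xs -> @sl K m n x &
    monomial_act (fun i => z i) a v = foldr (@Lie_dual K m n d) v xs].
    by have [xs [h1 h2] h3] := hU a; exists xs.
  have [xs xsP] := choice hU'.
  exists (fun phi => \sum_(cx <- [seq (c a, xs a) | a : 'X_{1..D < l.+1}])
    cx.1 *: foldr (@Lie_dual K m n d) phi cx.2).
    exists [seq (c a, xs a) | a : 'X_{1..D < l.+1}]; split=> // cx /mapP[a _ ->] /=.
    by case: (xsP a).
  rewrite big_image /=; apply: eq_bigr => a _; by case: (xsP a) => _ _ ->.
(* Starting from the value at the origin, a product of at most [l] operators only sees the
   [l]-jet. *)
have jet : depends_on_jet l (\sum_(cx <- r) cx.1 *: foldr (@Lie_dual K m n d) v cx.2).
  rewrite big_seq; apply: (big_ind (depends_on_jet l)) => [s //|x y hx hy s hs|cx /rl [sz _] s hs].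
    by rewrite -[LHS]/(x s + y s) hx ?hy ?addr0.
  rewrite -[LHS]/(cx.1 * foldr (@Lie_dual K m n d) v cx.2 s).
  have h0 : depends_on_jet 0 v.
    by move=> t ht; have [k k0 ->] := hv; rewrite ht ?mulr0 // mdeg0.
  by rewrite (depends_on_jetW sz (@depends_on_jet_foldr cx.2 v h0) hs) mulr0.
move: (\sum_(cx <- r) _) jet => phi jet.
have hm' (a : 'X_{1..D < l.+1}) : exists c : K, c != 0 /\
    forall s, monomial_act (fun i => z i) a v s = c * (chart s)@_a.
  by have [c c0 cE] := hm a; exists c.
have [k kP] := choice hm'.
exists (fun a => phi (sig a) / k a); apply/val_inj/funext => s /=.
(* [s'] is [s] without its Taylor polynomial of order [l], so [phi] kills it and [phi s] is
   determined by the values on the [sig a]. *)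
pose s' := s - \sum_(a : 'X_{1..D < l.+1}) (chart s)@_a *: sig a.
have : phi s' = 0.
  apply: jet => a al; rewrite /s' raddfB raddf_sum mcoeffB /=.
  under eq_bigr => a' _ do rewrite linearZ /= sigE.
  rewrite mcoeff_sumX; have al' : (mdeg a < l.+1)%N by rewrite ltnS.
  rewrite (bigD1 (BMultinom al')) //= eqxx mulr1 big1 ?addr0 ?subrr // => a' a'a.
  by rewrite -[a]/(val (BMultinom al')) -bmeqP (negbTE a'a) mulr0.
rewrite -[phi s']/(dual_linear phi s') /s' linearB linear_sum => /eqP; rewrite subr_eq0 => /eqP sE.
rewrite -[LHS]/(dual_linear phi s) sE.
rewrite evE; apply: eq_bigr => a _.
have [ka kE] := kP a; rewrite kE linearZ /= -[LHS]/((chart s)@_a * phi (sig a)).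
by rewrite mulrA divfK // mulrC.
Qed.

End Filtration.

(** * The highest weight vector *)

Section HighestWeight.
Variables (K : fieldType) (charK : [pchar K] =i pred0) (m n d : nat).
Implicit Types (s : H0 K m n d) (A B : frame K m n) (Y : 'M[K]_(n, m)).
Variables (v : dual (H0 K m n d)) (hv : highest_weight_vector v).

Lemma hwD s t : v (s + t) = v s + v t.
Proof. exact: (linearD (dual_linear v)). Qed.

Lemma hwB s t : v (s - t) = v s - v t.
Proof. exact: (linearB (dual_linear v)). Qed.

Lemma hwZ a s : v (a *: s) = a * v s.
Proof. by rewrite -[v _]/(dual_linear v _) linearZ. Qed.

Lemma hw_sum (I : Type) r (P : pred I) (F : I -> H0 K m n d) :
  v (\sum_(i <- r | P i) F i) = \sum_(i <- r | P i) v (F i).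
Proof. exact: (linear_sum (dual_linear v)). Qed.

Lemma hw_neq0 : exists s, v s != 0.
Proof.
apply/not_existsP => h; case/eqP: hv.1; apply/val_inj/funext => s.
by apply/eqP/negPn/negP => /h.
Qed.

(** [v] is an eigenvector of each [g i], hence of any combination of translations; by density the
    formula for [T] is only required on the big cell. *)
Lemma hw_average (I : finType) (g : I -> SL K m n) (kappa : I -> K)
    (T : H0 K m n d -> H0 K m n d) :
  (forall i, upper_triangular (val (g i))) ->
  (forall s Y, T s (cell Y) = \sum_i kappa i * s (SL_frame (g i) (cell Y))) ->
  exists lam, forall s, v (T s) = lam * v s.
Proof.
move=> gU TE.
have hc i : exists c, SL_dual (g i) v = c *: v by exact: (hv.2 _ (gU i)).
have [c cE] := choice hc.
exists (\sum_i kappa i * c i) => s.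
have -> : T s = \sum_i kappa i *: SL_act d (SL_inv (g i)) s.
  apply: (section_inj charK) => Y; rewrite TE.
  have evE (F : I -> H0 K m n d) A : (\sum_i F i : H0 K m n d) A = \sum_i F i A.
    by elim/big_ind2: _ => [//|x x' y y' <- <-|].
  rewrite evE; apply: eq_bigr => i _; congr (_ * s _).
  by apply/val_inj => /=; rewrite invmxK.
rewrite hw_sum mulr_suml; apply: eq_bigr => i _; rewrite hwZ -mulrA; congr (_ * _).
by rewrite -[LHS]/(SL_dual (g i) v s) cE.
Qed.

(** * Positive root vectors annihilate [v] *)

Section RootVector.
Variables p q : 'I_(m + n).
Hypothesis pq : (p < q)%N.
Let E : 'M[K]_(m + n) := delta_mx p q.

Lemma root_upper t : upper_triangular (1%:M - t *: E).
Proof.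
move=> i j ji; rewrite !mxE -[i == j]negbK neq_ltn ji orbT /= sub0r.
case: eqP => [ip|]; last by rewrite mulr0 oppr0.
case: eqP => [jq|]; last by rewrite mulr0 oppr0.
by move: ji; rewrite ip jq ltnNge ltnW.
Qed.

Lemma root_det t : \det (1%:M - t *: E) == 1.
Proof.
rewrite -det_tr det_trig.
  rewrite big1 // => i _; rewrite !mxE eqxx; case: eqP => [->|]; last by rewrite mulr0 subr0.
  by case: eqP => [pq'|]; [move: pq; rewrite pq' ltnn | rewrite mulr0 subr0].
apply/is_trig_mxP => i j ij; rewrite mxE; exact: root_upper.
Qed.

(** [E] squares to 0, so these matrices form a one-parameter group. *)
Lemma root_mul t t' : (1%:M - t *: E) *m (1%:M - t' *: E) = 1%:M - (t + t') *: E.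
Proof.
rewrite mulmxBl mul1mx mulmxBr mulmx1 -scalemxAl -scalemxAr mul_delta_mx_cond.
have -> : (q == p) = false by apply/negbTE; rewrite neq_ltn pq orbT.
by rewrite mulr0n !scaler0 subr0 scalerDl opprD addrA addrAC.
Qed.

Definition root_elt t : SL K m n := exist (fun g : 'M[K]_(m + n) => \det g == 1) _ (root_det t).

(** [E] has rank one, so its root subgroup moves [A] along a line to which [section_line]
    applies. *)
Lemma root_line s A : exists2 g : {poly K}, (size g <= d.+1)%N &
  forall t B, val B = (1%:M - t *: E) *m val A -> s B = g.[t].
Proof.
have AE t : (1%:M - t *: E) *m val A = val A + t *: (- delta_mx p ord0 *m row q (val A)).
  rewrite mulmxBl mul1mx mulNmx scalerN -scalemxAl; congr (_ - _ *: _).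
  by rewrite rowE mulmxA mul_delta_mx.
have hr t : \rank (val A + t *: (- delta_mx p ord0 *m row q (val A)))%R == m.
  rewrite -AE; exact: (valP (SL_frame (root_elt t) A)).
have [g sg gE] := section_line charK s hr.
by exists g => // t B; rewrite AE; exact: gE.
Qed.

(** By the group law the curve through [B] is the curve through [A] with its parameter shifted by
    [t]; this allows iteration. *)
Lemma root_line_deriv s A (g : {poly K}) :
  (forall t B, val B = (1%:M - t *: E) *m val A -> s B = g.[t]) ->
  forall t B, val B = (1%:M - t *: E) *m val A -> Lie_act d E s B = g^`().[t].
Proof.
move=> gE t B hB; rewrite (@Lie_act_polynomial _ charK _ _ _ _ _ _ (g \Po ('X + t%:P))).
  by rewrite deriv_comp derivD derivX derivC addr0 mulr1 horner_comp !hornerE.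
by move=> t' B' hB'; rewrite (gE (t' + t)) ?horner_comp ?hornerE // hB' hB mulmxA root_mul.
Qed.

(** By interpolation [E] is a combination of unipotent translations, so [v] turns it into a scalar
    [lam]; nilpotency of [E] forces [lam = 0]. *)
Lemma hw_root s : v (Lie_act d E s) = 0.
Proof.
have [alpha alphaE] := interpolation d (deriv_at 0) (natr_inj_char0 charK).
have [lam lamE] : exists lam, forall s, v (Lie_act d E s) = lam * v s.
  apply: (@hw_average _ (fun i : 'I_d.+1 => root_elt i%:R) alpha) => [i|t Y].
    exact: root_upper.
  have [g sg gE] := root_line t (cell Y).
  rewrite (Lie_act_polynomial charK gE) -[LHS]/(deriv_at 0 g) alphaE //.
  by apply: eq_bigr => i _; congr (_ * _); apply/esym; apply: gE.
have it k t : v (iter k (Lie_act d E) t) = lam ^+ k * v t.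
  elim: k => [|k IH]; first by rewrite mul1r.
  by rewrite iterS lamE IH mulrA -exprS.
(* Along an orbit [E] acts as the derivative on polynomials of degree at most [d]. *)
have nil t : iter d.+1 (Lie_act d E) t = 0.
  apply/val_inj/funext => A.
  have [g sg gE] := root_line t A.
  have h k : forall u B, val B = (1%:M - u *: E) *m val A ->
      iter k (Lie_act d E) t B = g^`(k).[u].
    elim: k => [|k IH]; first exact: gE.
    by move=> u B hB; rewrite iterS derivnS; exact: (root_line_deriv IH).
  rewrite -[LHS]/(iter d.+1 (Lie_act d E) t A) (h _ 0) ?scale0r ?subr0 ?mul1mx //.
  by rewrite derivn_poly0 // horner0.
have [t vt] := hw_neq0.
have v0 : v 0 = 0 by exact: (linear0 (dual_linear v)).
move/eqP: (it d.+1 t); rewrite nil v0 eq_sym mulf_eq0 (negbTE vt) orbF expf_eq0 /=.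
by move=> /eqP lam0; rewrite lamE lam0 mul0r.
Qed.

End RootVector.
End HighestWeight.

(** * Matrix coordinates on the cell and the quadratic relation *)

Section StandardCoordinates.
Variables (K : fieldType) (charK : [pchar K] =i pred0) (m n d : nat).
Local Notation D := #|{: 'I_n * 'I_m}|.
Implicit Types (s : H0 K m n d) (A B : frame K m n) (Y : 'M[K]_(n, m)).

Definition std (l : 'I_D) : 'M[K]_(n, m) := delta_mx (enum_val l).1 (enum_val l).2.
Definition var (i : 'I_n) (j : 'I_m) : 'I_D := enum_rank (i, j).

Lemma mxdot_delta i j Y : mxdot (delta_mx i j) Y = Y i j.
Proof.
rewrite /mxdot (bigD1 i) //= [X in _ + X]big1 ?addr0 => [|i' /negbTE ii].
  rewrite (bigD1 j) //= big1 ?addr0 => [|j' /negbTE jj].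
    by rewrite mxE !eqxx mul1r.
  by rewrite mxE jj andbF mul0r.
by rewrite big1 // => j' _; rewrite mxE ii mul0r.
Qed.

Lemma sum_var (V : nmodType) (F : 'I_D -> V) :
  \sum_l F l = \sum_i \sum_j F (var i j).
Proof.
rewrite pair_bigA /= (reindex (enum_rank : 'I_n * 'I_m -> 'I_D)) /=.
  by apply: eq_bigr => -[i j] _.
by exists enum_val => x _; rewrite ?enum_rankK ?enum_valK.
Qed.

Lemma std_var i j : std (var i j) = delta_mx i j.
Proof. by rewrite /std /var enum_rankK. Qed.

Lemma var_eq i j i' j' : (var i j == var i' j') = (i == i') && (j == j').
Proof. by rewrite (inj_eq enum_rank_inj) -pair_eqE. Qed.

Lemma std_dual : dual_bases std std.
Proof.
split=> [Y|l l'].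
  rewrite sum_var [RHS]matrix_sum_delta; apply: eq_bigr => i _; apply: eq_bigr => j _.
  by rewrite std_var mxdot_delta.
rewrite {1}/std mxdot_delta /std mxE -(inj_eq enum_val_inj) -pair_eqE /=.
by rewrite andbC eq_sym [X in _ && X]eq_sym.
Qed.

Local Notation chart := (chart std).
Local Notation coord := (coord std).
Local Notation point := (point std).

Lemma coord_var Y i j : coord Y (var i j) = Y i j.
Proof. by rewrite /coord std_var mxdot_delta. Qed.

Lemma point_entry y i j : point y i j = y (var i j).
Proof. by rewrite -coord_var (pointK std_dual). Qed.

(** The added multiple of [s] cancels the trace term of [Lie_act_cell], leaving a polarization
    operator between columns; for [j = q] it is the Euler operator of a column. *)
Definition gl_op (j q : 'I_m) s : H0 K m n d :=
  Lie_act d (delta_mx (lshift n j) (lshift n q)) s + ((j == q)%:R * d%:R) *: s.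

Definition lower_op (i : 'I_n) (j : 'I_m) s : H0 K m n d :=
  - Lie_act d (delta_mx (rshift m i) (lshift n j)) s.

Definition raise_op (j : 'I_m) (i : 'I_n) s : H0 K m n d :=
  - Lie_act d (delta_mx (lshift n j) (rshift m i)) s.

Local Notation y i j := ('X_(var i j) : {mpoly K[D]}).
Local Notation "f ^d( i , j )" := (f^`M(var i j)) (at level 2, format "f ^d( i ,  j )").

Lemma delta_block_ul j q :
  delta_mx (lshift n j) (lshift n q) = block_mx (delta_mx j q) 0 0 0 :> 'M[K]_(m + n).
Proof.
apply/matrixP=> a b; rewrite !mxE; case: (split_ordP a) => a' ->; rewrite !mxE;
  case: (split_ordP b) => b' ->; by rewrite ?mxE ?(eq_lrshift, eq_rlshift, eq_lshift) ?andbF.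
Qed.

Lemma delta_block_ur j i :
  delta_mx (lshift n j) (rshift m i) = block_mx 0 (delta_mx j i) 0 0 :> 'M[K]_(m + n).
Proof.
apply/matrixP=> a b; rewrite !mxE; case: (split_ordP a) => a' ->; rewrite !mxE;
  case: (split_ordP b) => b' ->; by rewrite ?mxE ?(eq_lrshift, eq_rlshift, eq_lshift, eq_rshift) ?andbF.
Qed.

Lemma delta_block_dl i j :
  delta_mx (rshift m i) (lshift n j) = block_mx 0 0 (delta_mx i j) 0 :> 'M[K]_(m + n).
Proof.
apply/matrixP=> a b; rewrite !mxE; case: (split_ordP a) => a' ->; rewrite !mxE;
  case: (split_ordP b) => b' ->; by rewrite ?mxE ?(eq_lrshift, eq_rlshift, eq_lshift, eq_rshift) ?andbF.
Qed.

Lemma trace_delta k (a b : 'I_k) : \tr (delta_mx a b : 'M[K]_k) = (a == b)%:R.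
Proof.
rewrite /mxtrace (bigD1 a) //= big1 ?addr0 => [|c /negbTE ca].
  by rewrite mxE eqxx.
by rewrite mxE ca.
Qed.

Lemma mul_delta_entry k l r (Y : 'M[K]_(k, l)) (j : 'I_l) (q : 'I_r) i c :
  (Y *m delta_mx j q) i c = Y i j * (c == q)%:R.
Proof.
rewrite mxE (bigD1 j) //= big1 ?addr0 => [|a /negbTE aj]; rewrite mxE ?eqxx //.
by rewrite aj mulr0.
Qed.

Lemma chart_gl_op j q s : chart (gl_op j q s) = \sum_i y i j * (chart s)^d(i, q).
Proof.
apply: (chart_unique charK) => x.
rewrite raddf_sum /= -[RHS]/(_ (cell _) + _ * s (cell _)) delta_block_ul.
rewrite (Lie_act_cell charK std_dual) !(mul0mx, addr0, subr0) trace_delta -chartE.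
rewrite mulNr [d%:R * _]mulrC addrAC addNr add0r sum_var; apply: eq_bigr => i _.
rewrite (bigD1 q) //= big1 ?addr0 => [|c /negbTE cq].
  by rewrite coord_var mul_delta_entry eqxx mulr1 point_entry mevalM mevalXU.
by rewrite coord_var mul_delta_entry cq mulr0 mul0r.
Qed.

Lemma chart_lower_op i j s : chart (lower_op i j s) = (chart s)^d(i, j).
Proof.
rewrite /lower_op linearN /= delta_block_dl -std_var.
by rewrite (chart_Lie_lower charK std_dual) opprK.
Qed.

Lemma chart_raise_op j i s : chart (raise_op j i s) =
  d%:R *: (y i j * chart s) - \sum_k \sum_q y k j * y i q * (chart s)^d(k, q).
Proof.
apply: (chart_unique charK) => x.
rewrite -[RHS]/(- Lie_act _ _ _ (cell _)) delta_block_ur.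
rewrite (Lie_act_cell charK std_dual) !(mul0mx, addr0, add0r, subr0) opprD mevalB mevalZ mevalM mevalXU.
congr (_ - _).
  rewrite mulNr opprK mxtrace_mulC (_ : \tr _ = x (var i j)) ?mulrA //.
  rewrite /mxtrace (bigD1 i) //= big1 ?addr0 => [|k /negbTE ki]; rewrite mul_delta_entry.
    by rewrite eqxx mulr1 point_entry.
  by rewrite ki mulr0.
rewrite sum_var raddf_sum /=; apply: eq_bigr => k _; rewrite raddf_sum /=; apply: eq_bigr => q _.
rewrite coord_var mulmxA mxE (bigD1 i) //= big1 ?addr0 => [|c /negbTE ci].
  by rewrite mul_delta_entry eqxx mulr1 !point_entry !mevalM !mevalXU.
by rewrite mul_delta_entry ci mulr0 mul0r.
Qed.

Lemma mderiv_var i j k q : (y i j)^d(k, q) = ((i == k) && (j == q))%:R%:MP.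
Proof.
rewrite mderivX mnmE var_eq; case: eqP => [->|]; case: eqP => [->|] //=; rewrite ?scale0r ?mpolyC0 //.
by rewrite (_ : (_ - _)%MM = 0%MM) ?mpolyX0 ?scale1r //; apply/mnmP=> l; rewrite mnmBE subnn mnm0E.
Qed.

(** The purely second order part of the product of [gl_op j q] and [gl_op q j]. *)
Definition mixed j q (f : {mpoly K[D]}) : {mpoly K[D]} :=
  \sum_i \sum_k y i j * y k q * f^d(k, j)^d(i, q).

Lemma mixedC j q f : mixed j q f = mixed q j f.
Proof.
rewrite /mixed exchange_big /=; apply: eq_bigr => i _; apply: eq_bigr => k _.
by rewrite mderiv_comm [y k j * _]mulrC.
Qed.

Lemma chart_gl_op2 j q s :
  chart (gl_op j q (gl_op q j s) - gl_op j j s) = mixed j q (chart s).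
Proof.
rewrite linearB /= !chart_gl_op; apply/eqP; rewrite subr_eq; apply/eqP.
rewrite /mixed -big_split /=; apply: eq_bigr => i _.
rewrite linear_sum mulr_sumr /=.
rewrite [RHS]addrC -[X in X + _](_ : \sum_k y i j * ((k == i)%:R%:MP * (chart s)^d(k, j)) = _); last first.
  rewrite (bigD1 i) //= big1 ?addr0 => [|k /negbTE ->]; first by rewrite eqxx mpolyC1 mul1r.
  by rewrite mpolyC0 mul0r mulr0.
rewrite -big_split /=; apply: eq_bigr => k _.
by rewrite mderivM mderiv_var eqxx andbT mulrDr mulrA.
Qed.

(** The second order terms of the left side are the sum over [q] of [mixed j q]. Since [v] kills the
    left side, this Casimir relation constrains its weights. *)
Lemma chart_raise_lower j s :
  \sum_i raise_op j i (lower_op i j s) =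
  d%:R *: gl_op j j s - \sum_q (gl_op j q (gl_op q j s) - gl_op j j s).
Proof.
apply: (chart_inj charK std_dual); rewrite linearB linearZ !linear_sum /=.
under [in RHS]eq_bigr do rewrite chart_gl_op2.
under eq_bigr do rewrite chart_raise_op chart_lower_op.
rewrite sumrB chart_gl_op scaler_sumr sumrN; congr (_ - _).
under eq_bigr do rewrite exchange_big /=.
by rewrite exchange_big /=; apply: eq_bigr => q _; rewrite /mixed exchange_big.
Qed.

(** The relation [[E_jq, E_qj] = E_jj - E_qq], read off from the symmetry of [mixed]; it brings the
    operator killed by [v] to the outside. *)
Lemma gl_opC j q s :
  gl_op j q (gl_op q j s) - gl_op j j s = gl_op q j (gl_op j q s) - gl_op q q s.
Proof. by apply: (chart_inj charK std_dual); rewrite !chart_gl_op2 mixedC. Qed.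

Definition scale_col (j : 'I_m) t Y : 'M[K]_(n, m) :=
  \matrix_(i, q) (if q == j then t * Y i q else Y i q).

Lemma scale_col1 j Y : scale_col j 1 Y = Y.
Proof. by apply/matrixP=> i q; rewrite mxE mul1r if_same. Qed.

(** Scaling one column traces a line of rank one in the cell; along it the Euler operator is
    [t d/dt]. *)
Lemma column_line j s Y : exists2 g : {poly K}, (size g <= d.+1)%N &
  (forall t, s (cell (scale_col j t Y)) = g.[t]) /\
  (forall t, gl_op j j s (cell (scale_col j t Y)) = ('X * g^`()).[t]).
Proof.
have E t : cellmx (scale_col j t Y) = cellmx (scale_col j 0 Y) +
    t *: (col_mx (0 : 'cV_m) (col j Y) *m delta_mx ord0 j).
  rewrite mul_col_mx mul0mx scale_col_mx scaler0 add_col_mx addr0; congr col_mx.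
  apply/matrixP=> i q; rewrite !mxE (bigD1 ord0) //= big1 ?addr0 => [|a]; last by rewrite ord1.
  by rewrite !mxE eqxx /=; case: eqP => [->|_]; rewrite ?mulr1 ?mul0r ?add0r ?mulr0 ?addr0.
have hr t : \rank (cellmx (scale_col j 0 Y) +
    t *: (col_mx (0 : 'cV_m) (col j Y) *m delta_mx ord0 j))%R == m.
  by rewrite -E cell_subproof.
have [g sg gE] := section_line charK s hr.
have gE' t : s (cell (scale_col j t Y)) = g.[t] by apply: gE; rewrite -E.
exists g => //; split=> // t.
pose u (l : 'I_D) : {poly K} :=
  if (enum_val l).2 == j then coord Y l *: 'X else (coord Y l)%:P.
have uE t' l : (u l).[t'] = coord (scale_col j t' Y) l.
  have -> : l = var (enum_val l).1 (enum_val l).2 by rewrite /var -surjective_pairing enum_valK.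
  rewrite /u /var enum_rankK /= !coord_var mxE; case: ifP => _; last by rewrite hornerC.
  by rewrite hornerZ hornerX mulrC.
have -> : g = mmap (@polyC K) u (chart s).
  apply: (horner_inj_char0 charK) => t'; rewrite -gE' (chart_cell std_dual) horner_mmap.
  by apply: meval_eq => l; rewrite uE.
rewrite hornerM hornerX deriv_mmap horner_sum (chart_cell std_dual) chart_gl_op.
rewrite sum_var raddf_sum mulr_sumr /=; apply: eq_bigr => i _.
rewrite mevalM mevalXU coord_var mxE eqxx (bigD1 j) //= big1 ?addr0 => [|q /negbTE qj].
  rewrite hornerM horner_mmap {2}/u /var enum_rankK /= eqxx derivZ derivX hornerZ hornerC mulr1.
  rewrite -/(var i j) coord_var.
  have -> : (chart s)^d(i, j).@[coord (scale_col j t Y)] = (chart s)^d(i, j).@[fun l => (u l).[t]].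
    by apply: meval_eq => l; rewrite uE.
  by ring.
by rewrite hornerM {2}/u /var enum_rankK /= qj derivC horner0 mulr0.
Qed.

End StandardCoordinates.

(** * The highest weight vector is an evaluation *)

Section Uniqueness.
Variables (K : fieldType) (charK : [pchar K] =i pred0) (m n d : nat).
Implicit Types (s : H0 K m n d) (A B : frame K m n) (Y : 'M[K]_(n, m)).
Variables (v : dual (H0 K m n d)) (hv : highest_weight_vector v).

Lemma hw_gl_op (j q : 'I_m) s : (j < q)%N -> v (gl_op j q s) = 0.
Proof.
move=> jq; rewrite /gl_op hwD hwZ (_ : (j == q) = false) ?mul0r ?addr0 //.
  exact: hw_root.
by apply/negbTE; rewrite -val_eqE /= neq_ltn jq.
Qed.

Lemma hw_raise_op (j : 'I_m) (i : 'I_n) s : v (raise_op j i s) = 0.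
Proof.
rewrite /raise_op -scaleN1r hwZ hw_root ?mulr0 //=.
by rewrite (leq_trans (ltn_ord j)) // leq_addr.
Qed.

Section ColumnTorus.
Variable j : 'I_m.

(* Scaling the j-th coordinate by th^-(m+n) and then everything by th gives
   determinant 1; on the cell, this scales the j-th column by th^(m+n). *)
Definition torus_diag (k : nat) (c : 'I_k) (th : K) : 'rV[K]_k :=
  \row_i (if i == c then th * th ^- (m + n) else th).

Lemma torus_diag_det k (c : 'I_k) th :
  \det (diag_mx (torus_diag c th)) = th ^+ k * th ^- (m + n).
Proof.
rewrite det_diag (bigD1 c) //= mxE eqxx (eq_bigr (fun=> th)) => [|i /negbTE ic]; last by rewrite mxE ic.
rewrite prodr_const cardC1 card_ord mulrAC -exprS prednK //.
exact: leq_ltn_trans (leq0n c) (ltn_ord c).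
Qed.

Fact torus_subproof i : \det (diag_mx (torus_diag (lshift n j) i.+1%:R)) == 1.
Proof. by rewrite torus_diag_det divff // expf_neq0 // natr_neq0_char0. Qed.

Definition torus_elt i : SL K m n :=
  exist (fun g : 'M[K]_(m + n) => \det g == 1) _ (torus_subproof i).

Lemma hw_column_weight : exists mu, forall s, v (gl_op j j s) = mu * v s.
Proof.
(* The nodes are the factors by which the torus elements scale column [j]; the shift [i.+1] keeps
   them nonzero. *)
have x_inj : injective (fun i : nat => (i.+1%:R : K) ^+ (m + n)).
  move=> i i' /=; rewrite -!natrX => /(natr_inj_char0 charK) /eqP.
  rewrite eqn_exp2r ?addn_gt0 ?(leq_ltn_trans (leq0n j) (ltn_ord j)) //.
  by move=> /eqP[].
have [alpha alphaE] := interpolation d (deriv_at 1) x_inj.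
(* The factor of [section_mulr] picked up when the translated frame is brought back to the form
   [[1; Y]]. *)
pose ka (i : nat) : K := (i.+1%:R ^+ m * i.+1%:R ^- (m + n)) ^+ d.
apply: (@hw_average _ charK _ _ _ _ hv _ (fun i : 'I_d.+1 => torus_elt i)
  (fun i => alpha i / ka i)) => [i|s Y].
  by move=> a b ba; rewrite !mxE -[a == b]negbK neq_ltn ba orbT.
have [g sg [gE gH]] := column_line charK j s Y.
have := gH 1; rewrite scale_col1 hornerM hornerX mul1r => ->.
rewrite -[LHS]/(deriv_at 1 g) alphaE //; apply: eq_bigr => i _.
rewrite -mulrA; congr (_ * _).
have th0 : i.+1%:R != 0 :> K by rewrite natr_neq0_char0.
rewrite (@section_mulr _ _ _ _ s (cell (scale_col j (i.+1%:R ^+ (m + n)) Y)) _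
  (diag_mx (torus_diag j i.+1%:R))).
  rewrite torus_diag_det gE mulKf // expf_neq0 // mulf_neq0 ?invr_eq0 ?expf_neq0 //.
rewrite /= /cellmx mul_col_mx mul1mx; apply/matrixP=> a b.
rewrite mul_diag_mx mxE [RHS]mxE; case: (split_ordP a) => a' ->; rewrite mxE.
  by rewrite col_mxEu !mxE (inj_eq (@lshift_inj _ _)) mulr_natr.
rewrite col_mxEd eq_rlshift mul_mx_diag !mxE; case: ifP => [_|_]; last by rewrite mulrC.
have : i.+1%:R ^+ (m + n) != 0 :> K by rewrite expf_neq0.
by move: (_ ^+ _) => w w0; field.
Qed.

(** The product of the operators [H_j - r], which removes the components whose degree in column [j]
    lies in [rs]. *)
Definition weight_filter (rs : seq nat) s : H0 K m n d :=
  foldr (fun r t => gl_op j j t - r%:R *: t) s rs.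

Lemma hw_weight_filter mu rs s : (forall t, v (gl_op j j t) = mu * v t) ->
  v (weight_filter rs s) = \prod_(r <- rs) (mu - r%:R) * v s.
Proof.
move=> muE; elim: rs => [|r rs IH]; first by rewrite big_nil mul1r.
by rewrite /= hwB hwZ muE -mulrBl IH big_cons mulrA.
Qed.

(** [t d/dt - r] multiplies the coefficient of [t^k] by [k - r]. *)
Lemma weight_filter_cell rs s Y : exists2 g : {poly K}, (size g <= d.+1)%N &
  s (cell (scale_col j 0 Y)) = g`_0 /\
  forall t, weight_filter rs s (cell (scale_col j t Y)) =
    (\poly_(k < d.+1) (\prod_(r <- rs) (k%:R - r%:R) * g`_k)).[t].
Proof.
have [g sg [gE _]] := column_line charK j s Y.
exists g => //; split; first by rewrite gE horner_coef0.
elim: rs => [|r rs IH] t.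
  rewrite /= gE; congr (_.[t]); apply/polyP=> k; rewrite coef_poly.
  case: ltnP => [_|dk]; first by rewrite big_nil mul1r.
  by rewrite nth_default // (leq_trans sg).
set f := \poly_(k < d.+1) _ in IH.
have [h sh [hE hH]] := column_line charK j (weight_filter rs s) Y.
have hf : h = f by apply: (horner_inj_char0 charK) => t'; rewrite -hE IH.
rewrite -[LHS]/(gl_op j j (weight_filter rs s) (cell _) - r%:R * weight_filter rs s (cell _)).
rewrite hH IH hf -hornerZ -hornerN -hornerD; congr (_.[t]).
apply/polyP=> k; rewrite coefD coefN coefZ coefXM coef_deriv !coef_poly big_cons.
case: k => [|k] /=; first by rewrite !mulrA sub0r; ring.
case: ifP => _; rewrite ?mul0rn ?mulr0 ?subr0 // -mulr_natr; ring.
Qed.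

Lemma weight_filter_all s : weight_filter (iota 0 d.+1) s = 0.
Proof.
apply: (section_eq0 charK) => Y.
have [g _ [_ /(_ 1)]] := weight_filter_cell (iota 0 d.+1) s Y.
rewrite scale_col1 => ->; rewrite (_ : \poly_(k < _) _ = 0) ?horner0 //.
apply/polyP=> k; rewrite coef_poly coef0; case: ltnP => // kd.
rewrite (bigD1_seq k) ?mem_iota ?iota_uniq //= subrr !mul0r //.
Qed.

Lemma weight_filter_pos s Y : weight_filter (iota 1 d) s (cell Y) =
  \prod_(r <- iota 1 d) (- r%:R) * s (cell (scale_col j 0 Y)).
Proof.
have [g _ [-> /(_ 1)]] := weight_filter_cell (iota 1 d) s Y.
rewrite scale_col1 => ->; rewrite horner_poly big_ord_recl /= expr1n mulr1.
rewrite [X in _ + X]big1 ?addr0 => [|k _].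
  by congr (_ * _); apply: eq_bigr => r _; rewrite sub0r.
rewrite (bigD1_seq k.+1) ?mem_iota ?iota_uniq //= ?subrr ?mul0r //.
by rewrite add1n ltnS.
Qed.

(** Column degrees lie in [{0, ..., d}], so filtering all of them gives 0; applying [v] shows that
    its weight is one of them. *)
Lemma hw_column_weight_nat : exists2 r, (r <= d)%N & forall s, v (gl_op j j s) = r%:R * v s.
Proof.
have [mu muE] := hw_column_weight; have [s vs] := hw_neq0 hv.
have := hw_weight_filter (iota 0 d.+1) s muE.
have v0 : v 0 = 0 by exact: (linear0 (dual_linear v)).
rewrite weight_filter_all v0 => /esym/eqP; rewrite mulf_eq0 (negbTE vs) orbF.
rewrite prodf_seq_eq0 => /hasP[r]; rewrite mem_iota add0n ltnS /= => rd /eqP/eqP.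
by rewrite subr_eq0 => /eqP mur; exists r => // t; rewrite muE mur.
Qed.

End ColumnTorus.

(* On v, sum_i raise_op j i (lower_op i j _) vanishes; expressing it by means of
   the gl_op gives mu_j (d + m - j - mu_j) = 0. *)
Lemma hw_gl_diag j s : v (gl_op j j s) = 0.
Proof.
move: {2}(j : nat) (erefl (j : nat)) => k.
elim/ltn_ind: k j s => k IH j s jk.
have [r rd rE] := hw_column_weight_nat j.
suff r0 : r = 0%N by rewrite rE r0 mul0r.
have [t vt] := hw_neq0 hv.
have : v (\sum_i raise_op j i (lower_op i j t)) = 0.
  by rewrite hw_sum big1 // => i _; rewrite hw_raise_op.
rewrite (chart_raise_lower charK) hwB hwZ hw_sum rE.
(* The term [q = j] gives [r^2 - r], those with [q < j] vanish by [gl_opC] and induction, and each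
   of the [m - j - 1] terms with [q > j] gives [- r]. *)
have -> : \sum_q v (gl_op j q (gl_op q j t) - gl_op j j t) =
    (r%:R * r%:R - (m - j)%:R * r%:R) * v t.
  rewrite (bigD1 j) //= hwB !rE.
  rewrite (bigID (fun q : 'I_m => q < j)%N) /= big1 ?add0r => [|q /andP[_ qj]]; last first.
    rewrite (gl_opC charK) hwB hw_gl_op // (IH q) ?subr0 //; by rewrite -jk.
  rewrite (eq_bigr (fun=> - (r%:R * v t))) => [|q /andP[qj]]; last first.
    rewrite -leqNgt leq_eqVlt val_eqE eq_sym (negbTE qj) /= => jq.
    by rewrite hwB hw_gl_op // rE sub0r.
  rewrite sumr_const (_ : #|_| = (m - j).-1); last first.
    rewrite -sum1_card (eq_bigl (fun q : 'I_m => j.+1 <= q)%N) => [|q].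
      by rewrite -(big_geq_mkord _ _ xpredT (fun=> 1%N)) sum_nat_const_nat muln1 subnS.
    by rewrite unfold_in /= -leqNgt ltn_neqAle eq_sym.
  have -> : (m - j)%N = (m - j).-1.+1 by rewrite prednK // subn_gt0.
  rewrite mulrSr mulNrn -mulr_natl; ring.
move=> /eqP; rewrite mulrA -mulrBl mulf_eq0 (negbTE vt) orbF => /eqP h.
apply/eqP; rewrite -[_ == _]negbK; apply/negP => r0.
(* The second factor is nonzero, as [r <= d] and [j < m]. *)
have : r%:R * (d + (m - j) - r)%:R = 0 :> K.
  rewrite natrB ?natrD; first by rewrite -[RHS]h; ring.
  by rewrite (leq_trans rd) // leq_addr.
move/eqP; rewrite mulf_eq0 !((pcharf0P K).1 charK) (negbTE r0) /= subn_eq0 leqNgt.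
by rewrite (leq_ltn_trans rd) // -addn1 leq_add2l subn_gt0.
Qed.

(** As all column weights of [v] are 0, filtering degrees 1 to [d] scales [v s] by the same constant
    that multiplies the component of degree 0. *)
Lemma hw_zero_columns (js : seq 'I_m) s : exists2 t : H0 K m n d,
  v t = (\prod_(r <- iota 1 d) (- r%:R)) ^+ size js * v s &
  forall Y, t (cell Y) = (\prod_(r <- iota 1 d) (- r%:R)) ^+ size js *
    s (cell (foldr (fun j => scale_col j 0) Y js)).
Proof.
elim: js s => [|j js IH] s; first by exists s => [|Y]; rewrite mul1r.
have [t tv tE] := IH (weight_filter j (iota 1 d) s).
have mu0 u : v (gl_op j j u) = 0 * v u by rewrite hw_gl_diag mul0r.
exists t => [|Y]; rewrite ?tv ?tE.
  rewrite (hw_weight_filter _ _ mu0) mulrA exprSr; congr (_ * _ * _).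
  by apply: eq_bigr => r _; rewrite sub0r.
by rewrite weight_filter_pos mulrA exprSr.
Qed.

Lemma highest_weight_vector_eval : exists2 c : K, c != 0 & forall s, v s = c * s (cell 0).
Proof.
have h1 : ('X_(idx0 m n) ^+ d : {mpoly K[_]}) \is d.-homog.
  by rewrite -[X in X.-homog]mul1n dhomogMn // dhomogX /= mdeg1.
(* The section with chart 1; with all columns set to 0, every section becomes a multiple of it. *)
have [one oneE] := polynomial_section h1.
have one1 Y : one (cell Y) = 1.
  by rewrite oneE rmorphXn /= mevalXU plucker_idx0 det1 expr1n.
have vE s : v s = v one * s (cell 0).
  have [t tv tE] := hw_zero_columns (enum 'I_m) s.
  set C := _ ^+ _ in tv tE.
  have C0 : C != 0.
    rewrite expf_neq0 // prodf_seq_neq0; apply/allP => r; rewrite mem_iota => /andP[r0 _] /=.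
    by rewrite oppr_eq0 natr_neq0_char0 // -lt0n.
  apply: (mulfI C0); rewrite -tv.
  pose c : K := C * s (cell 0).
  have -> : t = c *: one.
    apply: (section_inj charK) => Y; rewrite tE -[RHS]/(_ * one (cell Y)) one1 mulr1.
    congr (_ * s (cell _)); apply/matrixP => i q; rewrite mxE.
    suff h js : (foldr (fun j => scale_col j 0) Y js) i q = if q \in js then 0 else Y i q.
      by rewrite h mem_enum.
    elim: js => //= j js IH; rewrite mxE IH in_cons.
    by case: eqP => [->|_]; rewrite ?mul0r.
  by rewrite hwZ /c mulrAC mulrA.
exists (v one) => //; have [s] := hw_neq0 hv; apply: contraNneq => z.
by rewrite vE z mul0r.
Qed.

End Uniqueness.

(** * Counting monomials, dual bases for the Lie algebra [n], and the conclusion *)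

(** Exponents of degree at most [l] are the [D]-tuples in [{0, ..., l}] with sum at most [l]. *)
Lemma card_bmultinom D l : #|{: 'X_{1..D < l.+1}}| = 'C(D + l, D).
Proof.
pose f (a : 'X_{1..D < l.+1}) : D.-tuple 'I_l.+1 := [tuple inord (a i) | i < D].
have fE (a : 'X_{1..D < l.+1}) i : tnth (f a) i = a i :> nat.
  rewrite tnth_mktuple inordK // (leq_ltn_trans _ (bmdeg a)) //.
  by rewrite mdegE (bigD1 i) //= leq_addr.
have f_inj : injective f.
  move=> a a' ff; apply/val_inj/mnmP => i; by rewrite -!fE ff.
rewrite -card_partial_ord_partitions -cardsT -(card_imset _ f_inj); congr #|pred_of_set _|.
apply/setP => t; rewrite inE; apply/imsetP/idP => [[a _ ->]|tl].
  rewrite big_tuple (eq_bigr (fun i => a i : nat)) => [|i _]; last exact: fE.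
  by rewrite -mdegE -ltnS bmdeg.
pose a := [multinom tnth t i : nat | i < D].
have al : (mdeg a < l.+1)%N.
  rewrite ltnS mdegE (eq_bigr (fun i => tnth t i : nat)) => [|i _]; last by rewrite mnmE.
  by rewrite -[X in (X <= _)%N](big_tuple _ _ t xpredT (fun i : 'I_l.+1 => i : nat)).
exists (BMultinom al) => //; apply: eq_from_tnth => i; apply/val_inj.
by rewrite /= fE mnmE.
Qed.

Lemma is_basis_has_dim (K : fieldType) (M : lmodType K) (S : set M) (I : finType)
  (b : I -> M) : is_basis S b -> has_dim S #|I|.
Proof.
move=> [b_free <-]; exists (b \o enum_val).
have sumE (c : 'I_#|I| -> K) :
    \sum_i c i *: (b \o enum_val) i = \sum_(i : I) c (enum_rank i) *: b i.
  rewrite (reindex (enum_rank : I -> 'I_#|I|)) /=; last first.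
    by exists enum_val => x _; rewrite ?enum_rankK ?enum_valK.
  by apply: eq_bigr => i _; rewrite enum_rankK.
split=> [c|]; first by rewrite sumE => /b_free h i; rewrite -(enum_valK i) h.
apply/seteqP; split=> w [c ->].
  by exists (c \o enum_rank); rewrite sumE.
by exists (c \o enum_val); rewrite sumE; apply: eq_bigr => i _; rewrite /= enum_rankK.
Qed.

Lemma lie_n_basis (K : fieldType) m n D (z : 'I_D -> 'M[K]_(m + n)) :
  is_basis (@lie_n K m n) z ->
  exists b cb : 'I_D -> 'M[K]_(n, m),
    dual_bases b cb /\ z = fun i => block_mx 0 0 (b i) 0.
Proof.
move=> [z_free z_span].
have zn i : exists Y : 'M[K]_(n, m), z i = block_mx 0 0 Y 0.
  have : lie_n (z i); last by [].
  rewrite -z_span; exists (fun j => (i == j)%:R).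
  rewrite (bigD1 i) //= eqxx scale1r big1 ?addr0 // => j ji.
  by rewrite eq_sym (negbTE ji) scale0r.
have [b bE] := choice zn.
have sumE (c : 'I_D -> K) :
    \sum_i c i *: z i = block_mx 0 0 (\sum_i c i *: b i) 0.
  rewrite (eq_bigr (fun i => block_mx 0 0 (c i *: b i) 0)) => [|i _]; last first.
    by rewrite bE scale_block_mx !scaler0.
  elim/big_rec2: _ => [|i Y X _ ->]; first by rewrite /block_mx !row_mx0 col_mx0.
  by rewrite add_block_mx !addr0.
have span Y : exists c : 'I_D -> K, Y = \sum_i c i *: b i.
  have : lie_n (block_mx 0 0 Y 0 : 'M[K]_(m + n)) by exists Y.
  rewrite -z_span => -[c]; rewrite sumE => /eq_block_mx[_ _ -> _]; by exists c.
have b_free (c c' : 'I_D -> K) : \sum_i c i *: b i = \sum_i c' i *: b i -> c =1 c'.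
  move=> h i; apply/eqP; rewrite -subr_eq0; apply/eqP.
  apply: (z_free (fun i => c i - c' i)); rewrite sumE.
  under eq_bigr do rewrite scalerBl.
  by rewrite sumrB h subrr /block_mx !row_mx0 col_mx0.
have hk (rc : 'I_n * 'I_m) := span (delta_mx rc.1 rc.2).
have [k kE] := choice hk.
(* The entries of [cb i] are the [i]-th coefficients of the elementary matrices in the basis [b]. *)
pose cb i : 'M[K]_(n, m) := \matrix_(r, c) k (r, c) i.
have gen Y : \sum_i mxdot (cb i) Y *: b i = Y.
  rewrite [RHS]matrix_sum_delta.
  under eq_bigr => i _.
    rewrite /mxdot scaler_suml; under eq_bigr => r _ do rewrite scaler_suml; over.
  rewrite exchange_big; apply: eq_bigr => r _; rewrite exchange_big; apply: eq_bigr => c _.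
  rewrite -[delta_mx r c]/(delta_mx (r, c).1 (r, c).2) kE scaler_sumr; apply: eq_bigr => i _.
  by rewrite mxE scalerA mulrC.
exists b, cb; split; last by apply/funext.
split=> // i j; apply: (b_free (fun i => mxdot (cb i) (b j)) (fun i => (i == j)%:R)).
rewrite gen (bigD1 j) //= eqxx scale1r big1 ?addr0 // => l /negbTE ->.
by rewrite scale0r.
Qed.

Theorem corollary4p14 (K : fieldType) (charK : [pchar K] =i pred0)
    (m n d l : nat) (l_gt0 : (1 <= l)%N) (l_le_d : (l <= d)%N)
    (v : dual (H0 K m n d)) (hv : highest_weight_vector v)
    (z : 'I_(m * n) -> 'M[K]_(m + n)) (hz : is_basis (@lie_n K m n) z) :
  is_basis (U_orbit l v)
    (fun a : 'X_{1..(m * n) < l.+1} => monomial_act z a v)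
  /\ has_dim (U_orbit l v) 'C(m * n + l, m * n).
Proof.
have [b [cb [b_dual ->]]] := lie_n_basis hz.
suff h : is_basis (U_orbit l v)
    (fun a : 'X_{1..(m * n) < l.+1} => monomial_act (fun i => block_mx 0 0 (b i) 0) a v).
  by split=> //; rewrite -card_bmultinom; exact: is_basis_has_dim h.
apply: (monomial_basis charK b_dual l_le_d).
(* Evaluation at [Y = 0] is the Taylor coefficient of order 0, the starting point required by
   [monomial_basis]. *)
have [c c0 cE] := highest_weight_vector_eval charK hv.
exists c => // s; rewrite cE; congr (_ * _).
rewrite -(_ : point b (fun=> 0) = 0); last by rewrite /point big1 // => i _; rewrite scale0r.
by rewrite -chartE meval_origin.
Qed.
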